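(* Let $A\in\mathbf{RM}_6$ be a reciprocal $6\times6$ matrix whose parameters $\xi_1,\dots,\xi_5\ge0$ satisfy the three equations $$\begin{aligned}& 2 \xi _1^2+4 \xi _2 \xi _1-2 \xi _3 \xi _1-3 \xi _4 \xi _1-3 \xi _5 \xi _1+\xi _2^2+\xi _4^2+2 \xi _5^2+2 \xi _2 \xi _3\\ & -5 \xi _2 \xi _4+2 \xi _3 \xi _4-3 \xi _2 \xi _5-2 \xi _3 \xi _5+4 \xi _4 \xi _5 = 0,\end{aligned}$$ $$\begin{aligned}& 2 \xi _1^2+\xi _2 \xi _1-3 \xi _3 \xi _1+\xi _4 \xi _1-3 \xi _5 \xi _1-\xi _2^2+\xi _3^2-\xi _4^2+2 \xi _5^2\\ &+2 \xi _2 \xi _3-2 \xi _2 \xi _4+2 \xi _3 \xi _4+\xi _2 \xi _5-3 \xi _3 \xi _5+\xi _4 \xi _5 = 0,\end{aligned}$$ $$\begin{aligned}& \xi _1^3+2 \xi _2 \xi _1^2+4 \xi _3 \xi _1^2+2 \xi _4 \xi _1^2+3 \xi _5 \xi _1^2-\xi _2^2 \xi _1+3 \xi _3^2 \xi _1-\xi _4^2 \xi _1+3 \xi _5^2 \xi _1+3 \xi _2 \xi _3 \xi _1-2 \xi _2 \xi _4 \xi _1\\ &+3 \xi _3 \xi _4 \xi _1+4 \xi _2 \xi _5 \xi _1-41 \xi _3 \xi _5 \xi _1+4 \xi _4 \xi _5 \xi _1-\xi _2^3-\xi _3^3-\xi _4^3+\xi _5^3+2 \xi _2 \xi _3^2-3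 \xi _2 \xi _4^2+\xi _3 \xi _4^2\\ &+2 \xi _2 \xi _5^2+4 \xi _3 \xi _5^2+2 \xi _4 \xi _5^2+\xi _2^2 \xi _3-3 \xi _2^2 \xi _4+2 \xi _3^2 \xi _4+2 \xi _2 \xi _3 \xi _4-\xi _2^2 \xi _5+3 \xi _3^2 \xi _5-\xi _4^2 \xi _5\\ &+3 \xi _2 \xi _3 \xi _5-2 \xi _2 \xi _4 \xi _5+3 \xi _3 \xi _4 \xi _5=0.\end{aligned}$$ For $j=1,2,3$ denote by $E_j$ the ellipse with foci $\pm2\cos\frac{j\pi}{7}$ and minor half-axis of length equal to the $j$th (in non-increasing order, counting multiplicities) eigenvalue of $\operatorname{Im}A$. Then, for $j=1,2,3$, the rank-$j$ numerical range $\Lambda_j(A)$ is the elliptical disk bounded by $E_j$.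
   Context: A matrix $A=(a_{ij})\in M_n(\mathbb C)$ is reciprocal, $A\in\mathbf{RM}_n$, if it is tridiagonal with zero main diagonal ($a_{ij}=0$ whenever $|i-j|\neq1$) and $a_{i,i+1}a_{i+1,i}=1$ for $i=1,\dots,n-1$. Its parameters are $\xi_j=\frac14(|a_{j,j+1}|-|a_{j+1,j}|)^2\ge 0$, $j=1,\dots,n-1$. Also $\operatorname{Im}A=(A-A^* )/(2i)$. The rank-$k$ numerical range of $A\in M_n(\mathbb C)$ is $\Lambda_k(A)=\{\lambda\in\mathbb C: PAP=\lambda P\text{ for some rank-}k\text{ orthogonal projection }P\}$. If the minor axis of an ellipse has length zero, the elliptical disk it bounds is the line segment joining its foci. *)

(* Defs.v *)
(* The complex numbers are R[i], for R : realType. *)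
From HB Require Import structures.
From mathcomp Require Import all_boot all_order all_algebra.
From mathcomp Require Import spectral.
From mathcomp Require Import complex.
From mathcomp Require Import classical_sets reals trigo.

Set Implicit Arguments.
Unset Strict Implicit.
Unset Printing Implicit Defensive.

Import Order.TTheory GRing.Theory Num.Theory.

Local Open Scope ring_scope.
Local Open Scope complex_scope.
Local Open Scope sesquilinear_scope.
Local Open Scope classical_set_scope.

Definition reciprocal (R : realType) (n : nat) (A : 'M[R[i]]_n) : Prop :=
  (forall i j : 'I_n, i.+1 != j -> j.+1 != i -> A i j = 0) /\
  (forall i j : 'I_n, i.+1 = j -> A i j * A j i = 1).

(* The index j is 1-based, meaningful for 1 <= j <= n, where A has size n + 1:
   rows and columns being numbered from 0, the pair (j - 1, j) below is
   the pair (j, j + 1) in 1-based numbering. *)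
Definition recip_param (R : realType) (n : nat) (A : 'M[R[i]]_n.+1) (j : nat)
    : R :=
  (ComplexField.Normc.normc (A (inord j.-1) (inord j))
   - ComplexField.Normc.normc (A (inord j) (inord j.-1))) ^+ 2 / 4.

Definition im_part (R : realType) (n : nat) (A : 'M[R[i]]_n) : 'M[R[i]]_n :=
  (2 * 'i)^-1 *: (A - A ^t*).

(* closed_field_poly_normal lists all the roots, with multiplicity. *)
Definition eigenvalues (R : realType) (n : nat) (A : 'M[R[i]]_n) : seq R[i] :=
  sval (closed_field_poly_normal (char_poly A)).

(* For A Hermitian: its (real) eigenvalues, with multiplicity, in
   non-increasing order. *)
Definition herm_eigenvalues (R : realType) (n : nat) (A : 'M[R[i]]_n) : seq R :=
  sort (fun x y : R => y <= x) [seq complex.Re z | z <- eigenvalues A].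

Definition numerical_range (R : realType) (n : nat) (k : nat) (A : 'M[R[i]]_n)
    : set R[i] :=
  [set lambda | exists P : 'M[R[i]]_n,
     [/\ P ^t* = P, P *m P = P, \rank P = k & P *m A *m P = lambda *: P]].

(* The disk bounded by the ellipse with foci f1, f2 and minor half-axis b:
   the major half-axis is sqrt (b^2 + c^2), where 2c is the distance between
   the foci.  For b = 0 this is the line segment [f1, f2]. *)
Definition elliptical_disk (R : realType) (f1 f2 : R[i]) (b : R) : set R[i] :=
  [set z | ComplexField.Normc.normc (z - f1) + ComplexField.Normc.normc (z - f2)
           <= 2 * Num.sqrt
                (b ^+ 2 + (ComplexField.Normc.normc (f1 - f2) / 2) ^+ 2)].

(* Main.v *)
(* The Hermitian matrix u Re A + v Im A is tridiagonal with zero diagonal and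
   off-diagonal entries of squared modulus xi_k (u^2 + v^2) + u^2, so its
   characteristic polynomial is a cubic in X^2 which is determined by
   s = u^2 + v^2 and tau = u^2.  The three equations say exactly that this cubic
   splits into the factors X^2 - (beta_j s + gamma_j tau), where
   gamma_j = (2 cos (j pi / 7))^2.  Its roots are simple for tau > 0, hence the
   beta_j are in the same order as the gamma_j, and they are the squares of the
   three largest eigenvalues of Im A.

   If P A P = z P with P of rank j, then u Re z + v Im z is at most the j-th
   eigenvalue of u Re A + v Im A, whose square is (beta_j + gamma_j) u^2 +
   beta_j v^2: these inequalities define the disk bounded by E_j.

   Conversely, let z be in that disk and M = A - z.  The polynomial
   det (M^* + X M) is a product of three self-inversive quadratics; when z is
   strictly inside E_1, ..., E_j, the first j of them have no root on the unit
   circle, and each one lets us split off an M-isotropic vector.  This produces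
   a j-dimensional isotropic subspace for M, i.e. a point of the rank-j
   numerical range.  In general, we replace the parameters xi_k with
   xi_k + epsilon, which puts z strictly inside E_1, ..., E_j, and let epsilon
   tend to 0 by compactness. *)

Require Import Defs.
From HB Require Import structures.
From mathcomp Require Import all_boot all_order all_algebra.
From mathcomp Require Import spectral.
From mathcomp Require Import complex.
From mathcomp Require Import classical_sets reals trigo.
From mathcomp Require Import boolp topology normedtype derive.
From mathcomp Require Import zify ring lra.

Set Implicit Arguments.
Unset Strict Implicit.
Unset Printing Implicit Defensive.

Import Order.TTheory GRing.Theory Num.Theory.
Import numFieldNormedType.Exports.

Local Open Scope ring_scope.
Local Open Scope sesquilinear_scope.

(** * Isotropic subspaces of a matrix pencil *)

(** Expansion along the first row, then the first column. It serves both the tridiagonal recurrence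
    and the deflation. *)
Lemma det_two_step (T : comNzRingType) r (N : 'M[T]_(2 + r)) :
  (forall j, N 0 (rshift 2 j) = 0) -> (forall i, N (rshift 2 i) 0 = 0) ->
  \det N = N 0 0 * \det (row' 0 (col' 0 N)) - N 0 1 * N 1 0 * \det (drsubmx N).
Proof.
move=> N0r Nr0.
have l2 (j : 'I_r) : lift ord0 (lift ord0 j) = rshift 2 j :> 'I_(2 + r).
  by apply: val_inj.
have l01 : lift ord0 ord0 = 1 :> 'I_(2 + r) by apply: val_inj.
have l10 : lift 1 ord0 = 0 :> 'I_(2 + r) by apply: val_inj.
rewrite (expand_det_row N 0) !big_ord_recl big1 => [|j _]; last first.
  by rewrite l2 N0r mul0r.
rewrite addr0 l01 /cofactor /= !add0n expr0 expr1 mul1r; congr (_ + _).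
rewrite mulN1r mulrN -mulrA; congr (- (_ * _)).
rewrite (expand_det_col _ 0) big_ord_recl big1 => [|i _]; last first.
  by rewrite !mxE l10 l2 Nr0 mul0r.
rewrite addr0 !mxE l10 l01 /cofactor /= expr0 mul1r; congr (_ * \det _).
apply/matrixP => i j; rewrite !mxE; congr (N _ _); apply: val_inj => //=.
Qed.

(* If a tridiagonal matrix of order 6 has constant diagonal d and w_k is the
   product of its k-th pair of off-diagonal entries, its determinant is
   match6 w1 .. w5 (d ^+ 2). *)
Definition match6 (T : pzRingType) (w1 w2 w3 w4 w5 z : T) : T :=
  z ^+ 3 - (w1 + w2 + w3 + w4 + w5) * z ^+ 2
  + (w1 * w3 + w1 * w4 + w1 * w5 + w2 * w4 + w2 * w5 + w3 * w5) * z
  - w1 * w3 * w5.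

Lemma det_tridiag_step (T : comNzRingType) r (f : nat -> nat -> T) :
  (forall i j : nat, i.+1 != j -> j.+1 != i -> i != j -> f i j = 0) ->
  forall k, \det (\matrix_(i < r.+2, j < r.+2) f (k + i)%N (k + j)%N) =
    f k k * \det (\matrix_(i < r.+1, j < r.+1) f (k.+1 + i)%N (k.+1 + j)%N)
    - f k k.+1 * f k.+1 k * \det (\matrix_(i < r, j < r) f (k.+2 + i)%N (k.+2 +
        j)%N).
Proof.
move=> f0 k; rewrite (@det_two_step _ r) => [|j|i]; last 2 first.
- by rewrite !mxE f0 //=; lia.
- by rewrite !mxE f0 //=; lia.
rewrite !mxE /= !addn0 addn1; congr (_ - _); congr (_ * _); congr (\det _).
- apply/matrixP => i j; rewrite !mxE /= /bump /= !add1n !addnS //.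
- apply/matrixP => i j; rewrite !mxE /= !addnA addn2 //.
Qed.

Lemma det_tridiag6 (T : comNzRingType) (f : nat -> nat -> T) (d : T) :
  (forall i j : nat, i.+1 != j -> j.+1 != i -> i != j -> f i j = 0) ->
  (forall i, f i i = d) ->
  \det (\matrix_(i < 6, j < 6) f i j) =
  match6 (f 0%N 1%N * f 1%N 0%N) (f 1%N 2%N * f 2%N 1%N) (f 2%N 3%N * f 3%N 2%N)
         (f 3%N 4%N * f 4%N 3%N) (f 4%N 5%N * f 5%N 4%N) (d ^+ 2).
Proof.
move=> f0 fd.
have /= E := det_tridiag_step _ f0.
have -> : (\matrix_(i < 6, j < 6) f i j) = (\matrix_(i < 6, j < 6) f (0 + i)%N
  (0 + j)%N) by [].
rewrite !E !det_mx00 det_mx11 !mxE !fd /match6.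
ring.
Qed.

Section Isotropic.
Variable C : numClosedFieldType.
Implicit Types n : nat.

(** For [|a| = 1] and [a = c ^+ 2], the value at [a] is [c] times the Hermitian matrix c M + c^*
    M^*. *)
Definition pencil n (M : 'M[C]_n) : 'M[{poly C}]_n :=
  map_mx polyC (M ^t*) + 'X *: map_mx polyC M.

Lemma adjM m n p (A : 'M[C]_(m, n)) (B : 'M_(n, p)) :
  (A *m B)^t* = B^t* *m A^t*.
Proof. by rewrite trmx_mul map_mxM. Qed.

Lemma adjD m n (A B : 'M[C]_(m, n)) : (A + B)^t* = A^t* + B^t*.
Proof. by rewrite linearD map_mxD. Qed.

Lemma adjZ m n a (A : 'M[C]_(m, n)) : (a *: A)^t* = a^* *: A^t*.
Proof. by rewrite linearZ map_mxZ. Qed.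

Lemma adj0 m n : (0 : 'M[C]_(m, n))^t* = 0.
Proof. by rewrite trmx0 map_mx0. Qed.

Lemma adj_col_mx m1 m2 n (A : 'M[C]_(m1, n)) (B : 'M[C]_(m2, n)) :
  (col_mx A B)^t* = row_mx (A^t*) (B^t*).
Proof. by rewrite tr_col_mx map_row_mx. Qed.

(** The rows of [W] come from Gram-Schmidt on the orthogonal complement of the rows of [Q]. *)
Lemma unitarymx_complete m n (Q : 'M[C]_(m, n)) : Q \is unitarymx ->
  exists r (W : 'M[C]_(r, n)), (m + r = n)%N /\ col_mx Q W \is unitarymx.
Proof.
move=> uQ; pose K := kermx (Q^t*); pose W := schmidt (row_base K).
have uW : W \is unitarymx by rewrite schmidt_unitarymx ?rank_leq_col.
have rQ : \rank (Q^t*) = m by rewrite mxrank_map mxrank_tr (mxrank_unitary uQ).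
have WQ : W *m Q^t* = 0.
  apply/sub_kermxP; rewrite eqmx_schmidt_free ?row_base_free //.
  by rewrite eq_row_base.
exists (\rank K), W; split.
  by rewrite mxrank_ker rQ subnKC // -[X in (X <= _)%N]rQ rank_leq_row.
apply/unitarymxP; rewrite adj_col_mx mul_col_row (unitarymxP uQ) (unitarymxP
  uW).
rewrite WQ -[Q *m W^t*]trmxCK adjM trmxCK WQ adj0.
by rewrite -scalar_mx_block.
Qed.

Lemma pencilE n (M : 'M[C]_n) i j :
  pencil M i j = ((M j i)^*)%:P + 'X * (M i j)%:P.
Proof. by rewrite !mxE. Qed.

Lemma pencil_mul m n (U : 'M[C]_(m, n)) (M : 'M[C]_n) :
  pencil (U *m M *m U^t*) =
  map_mx polyC U *m pencil M *m map_mx polyC (U^t*).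
Proof.
rewrite /pencil adjM trmxCK adjM mulmxDr mulmxDl -scalemxAr -scalemxAl.
by rewrite -!(map_mxM polyC) mulmxA.
Qed.

Lemma det_pencil_unitary m n (U : 'M[C]_(m, n)) (M : 'M[C]_n) : m = n ->
  U \is unitarymx -> \det (pencil (U *m M *m U^t*)) = \det (pencil M).
Proof.
move=> mn; case: n / mn M U => M U uU.
rewrite pencil_mul !det_mulmx mulrAC -det_mulmx -map_mxM (unitarymxP uU).
by rewrite map_mx1 det1 mul1r.
Qed.

Lemma pencil_horner n (M : 'M[C]_n) a :
  (\det (pencil M)).[a] = \det (M^t* + a *: M).
Proof.
rewrite -horner_evalE -det_map_mx; congr (\det _); apply/matrixP => i j.
by rewrite !mxE /= horner_evalE !hornerE.
Qed.

Lemma normalize_row n (v : 'rV[C]_n) : v != 0 ->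
  exists2 c : C, c != 0 & (c *: v) *m (c *: v)^t* = 1%:M.
Proof.
move=> v0; have := dotmx_is_dotmx v0; rewrite dotmxE => vv.
set d := (_ *m _) 0 0 in vv.
exists (sqrtC d)^-1; first by rewrite invr_eq0 sqrtC_eq0 gt_eqF.
rewrite adjZ -scalemxAl -scalemxAr scalerA.
rewrite [v *m _]mx11_scalar -/d scale_scalar_mx.
have sd : (sqrtC d)^-1 \is Num.real by rewrite ger0_real // invr_ge0 sqrtC_ge0
  ltW.
rewrite (CrealP sd) -invfM -expr2 sqrtCK mulVf // gt_eqF //.
Qed.

(* Deflation.  If v (M^* + m M) = 0 and |m| <> 1 then v M v^* = 0, since this
   number and its conjugate differ by the factor - m.  As v M and v M^* are
   proportional, say to w, both forms vanish between v and W := <v, w>^perp;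
   in the basis (v, w, W) the determinant of the pencil loses the factor
   (X - m)(1 - m^* X) when M is replaced with its compression to W. *)
Lemma isotropic_subspace n (M : 'M[C]_n) (mus : seq C) :
  \det (pencil M) != 0 -> all (fun m => `|m| != 1) mus ->
  \prod_(m <- mus) (('X - m%:P) * (1 - m^* *: 'X)) %| \det (pencil M) ->
  exists2 V : 'M[C]_(size mus, n), V \is unitarymx & V *m M *m V^t* = 0.
Proof.
elim: mus n M => [|m mus IH] n M pM0 /=.
  move=> _ _; exists 0; last by rewrite mul0mx mul0mx.
  by apply/unitarymxP; apply/matrixP => -[].
move=> /andP[m1 mus1]; rewrite big_cons => dv.
have : root (\det (pencil M)) m.
  rewrite -dvdp_XsubCl; apply: dvdp_trans dv.
  by rewrite -mulrA dvdp_mulr.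
rewrite rootE pencil_horner => /det0P[v0 v00 v0M].
have [c c0] := normalize_row v00; set v := c *: v0 => vv.
have vM : v *m M^t* = - m *: (v *m M).
  have : v *m (M^t* + m *: M) = 0 by rewrite /v -scalemxAl v0M scaler0.
  by rewrite mulmxDr -scalemxAr scaleNr => /eqP; rewrite addr_eq0 => /eqP.
move: v vv vM => {v0 v00 v0M c c0} v vv vM.
have v0 : v != 0.
  by apply: contra_eq_neq vv => ->; rewrite mul0mx eq_sym oner_eq0.
have vMv : v *m M *m v^t* = 0.
  set e := _ *m _; have ee : e^t* = - m *: e.
    by rewrite /e !adjM trmxCK mulmxA vM -scalemxAl.
  apply/eqP/contraT => e0; have [x xe] : exists x, e = x%:M.
    by exists (e 0 0); rewrite -mx11_scalar.
  have x0 : x != 0 by apply: contra_neq e0 => x0; rewrite xe x0 raddf0.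
  move: ee; rewrite xe => /matrixP/(_ 0 0); rewrite !mxE eqxx !mulr1n.
  move/(congr1 Num.norm); rewrite norm_conjC normrM normrN => /eqP.
  rewrite -{1}[`|x|]mul1r (inj_eq (mulIf _)) ?normr_eq0 // eq_sym.
  by rewrite (negPf m1).
(* Otherwise v M^* vanishes too, and [v] lies in the kernel of the whole pencil. *)
have ell0 : v *m M != 0.
  apply: contraNneq pM0 => vM0; apply/det0P.
  exists (map_mx polyC v); first by rewrite map_mx_eq0.
  rewrite mulmxDr -scalemxAr -!map_mxM vM vM0.
  by rewrite scaler0 !map_mx0 scaler0 addr0.
have [c c0] := normalize_row ell0; set w := c *: _ => ww.
have [rho rho0 vMw] : exists2 rho, rho != 0 & v *m M = rho *: w.
  by exists c^-1; rewrite ?invr_eq0 // scalerA mulVf // scale1r.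
have wv : w *m v^t* = 0 by rewrite /w -scalemxAl vMv scaler0.
clearbody w.
have vw : v *m w^t* = 0 by rewrite -[v *m _]trmxCK adjM trmxCK wv adj0.
have uQ : col_mx v w \is unitarymx.
  apply/unitarymxP; rewrite adj_col_mx mul_col_row vv ww vw wv.
  by rewrite -scalar_mx_block.
have [r [W [rn uU]]] := unitarymx_complete uQ.
have := uU; move=> /unitarymxP; rewrite !adj_col_mx mul_col_row.
rewrite scalar_mx_block => /eq_block_mx[_ QW WQ WW].
move: QW WQ; rewrite mul_col_mx mul_mx_row.
rewrite -[0 in X in X -> _]vsubmxK -[0 in X in _ -> X -> _]hsubmxK.
rewrite !linear0 => /eq_col_mx[vW wW] /eq_row_mx[Wv Ww].
have Mv : M *m v^t* = - m^* *: (rho^* *: w^t*).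
  rewrite -[M *m _]trmxCK adjM trmxCK vM vMw !adjZ rmorphN.
  by rewrite scaleNr.
set N := W *m M *m W^t*.
pose q : {poly C} := ('X - m%:P) * (1 - m^* *: 'X).
(* In the new basis, row and column 0 of the pencil have nonzero entries only at (0, 1) and (1, 0),
   namely [rho ('X - m)] and [rho^* (1 - m^* 'X)]. *)
have pM : \det (pencil M) = - (`|rho| ^+ 2)%:P * q * \det (pencil N).
  rewrite -(det_pencil_unitary M rn uU) !adj_col_mx !mul_col_mx !mul_mx_row.
  rewrite vMv vMw -!scalemxAl ww wW -[W *m M *m v^t*]mulmxA -[w *m M *m
    v^t*]mulmxA Mv.
  rewrite -!scalemxAr ww Ww !scaler0 -/N.
  set X := col_mx _ _.
  have e0 : 0 = lshift r (lshift 1 0) :> 'I_(1 + 1 + r) by apply: val_inj.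
  have e1 : 1 = lshift r (rshift 1 0) :> 'I_(1 + 1 + r) by apply: val_inj.
  have X00 : X 0 0 = 0.
    by rewrite e0 /X !col_mxEu !row_mxEl mxE.
  have X01 : X 0 1 = rho.
    by rewrite e0 e1 /X !col_mxEu row_mxEl row_mxEr !mxE eqxx mulr1.
  have X10 : X 1 0 = - m^* * rho^*.
    by rewrite e0 e1 /X col_mxEu col_mxEd !row_mxEl !mxE eqxx mulr1.
  have X0r j : X 0 (rshift 2 j) = 0.
    by rewrite e0 /X !col_mxEu row_mxEr mxE.
  have Xr0 j : X (rshift 2 j) 0 = 0.
    by rewrite e0 /X col_mxEd row_mxEl row_mxEl mxE.
  have Xr i j : X (rshift 2 i) (rshift 2 j) = N i j.
    by rewrite /X col_mxEd row_mxEr.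
  rewrite (@det_two_step _ r) => [|j|i]; last 2 first.
  - by rewrite pencilE X0r Xr0 conjC0 mulr0 addr0.
  - by rewrite pencilE X0r Xr0 conjC0 mulr0 addr0.
  rewrite !pencilE X00 X01 X10 conjC0 mulr0 addr0 mul0r sub0r -mulNr.
  congr (_ * _); last first.
    congr (\det _); apply/matrixP => i j.
    by rewrite [LHS]mxE [LHS]mxE !pencilE !Xr.
  have -> : (- m^* * rho^*)^* = - m * rho by rewrite rmorphM rmorphN /= !conjCK.
  rewrite /q normCK -mul_polyC !polyCM !polyCN; ring.
suff [V uV VMV] : exists2 V : 'M_(1 + size mus, n), V \is unitarymx & V *m M *m
  V^t* = 0.
  by exists V.
have rho2 : (`|rho| ^+ 2)%:P != 0 :> {poly C}.
  by rewrite polyC_eq0 expf_eq0 normr_eq0.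
have q0 : q != 0.
  by apply: contraNneq pM0; rewrite pM => ->; rewrite mulr0 mul0r.
have [||V uV VMV] := IH r N _ mus1.
- by apply: contraNneq pM0; rewrite pM => ->; rewrite mulr0.
- move: dv; rewrite pM -/q !mulNr -mulrA dvdpNr mul_polyC dvdpZr.
    by rewrite dvdp_mul2l.
  by rewrite -polyC_eq0.
(* Both v M and the adjoint of M v^* are multiples of [w], which is orthogonal to [W]: the mixed
   terms vanish. *)
exists (col_mx v (V *m W)).
  apply/unitarymxP; rewrite adj_col_mx mul_col_row vv adjM.
  rewrite mulmxA vW mul0mx -!mulmxA Wv mulmx0 (mulmxA W) WW mul1mx.
  by rewrite (unitarymxP uV) -scalar_mx_block.
rewrite adj_col_mx adjM mul_col_mx mul_col_row vMv vMw.
rewrite mulmxA -[V *m W *m M *m v^t*]mulmxA Mv -!scalemxAr -[V *m W *m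
  w^t*]mulmxA.
rewrite -!scalemxAl wW Ww mul0mx mulmx0 !scaler0.
have -> : V *m W *m M *m (W^t* *m V^t*) = 0 by rewrite -VMV /N !mulmxA.
by rewrite block_mx0.
Qed.
End Isotropic.

(** * Factorization of the matching polynomial *)

(* Quantified over all morphisms f because it is used both over R and over
   polynomials with complex coefficients. *)
Definition match6_splits (R : pzRingType) (x1 x2 x3 x4 x5 : R) (b g : nat -> R)
  :=
  forall (T : comNzRingType) (f : {rmorphism R -> T}) (s tau z : T),
  match6 (f x1 * s + tau) (f x2 * s + tau) (f x3 * s + tau) (f x4 * s + tau)
    (f x5 * s + tau) z =
  \prod_(j < 3) (z - (f (b j) * s + f (g j) * tau)).

Section Splitting.
Variables (R : realFieldType) (t x1 x2 x3 x4 x5 : R).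
Let p := x1 + x5.
Let q := x2 + x4.
Let r := x3.

(* With t = 2 cos (2 pi / 7), slope7 j is (2 cos ((j + 1) pi / 7)) ^+ 2.  The
   heights solve the three equations, linear in them, obtained by comparing in
   match6_splits the coefficients of degree 1 in s; the other three equations
   are then h1, h2, h3 modulo the minimal polynomial of t, and the cofactors
   below are the quotients of the division by that polynomial. *)
Definition slope7 (j : nat) : R := nth 0 [:: 2 + t; t ^+ 2; 3 - t - t ^+ 2] j.

Definition height7 (j : nat) : R :=
  nth 0 [:: (2 * r - p) * t ^+ 2 + (2 * q + 3 * r) * t + (4 * p + 3 * q);
            (p + 2 * q + r) * t ^+ 2 + (p - 2 * r) * t + (p - q);
            (5 * q + 2 * p + 7 * r) - (p + 2 * q + r) * t
              - (2 * q + 3 * r) * t ^+ 2] j / 7.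

Hypothesis ht : t ^+ 3 + t ^+ 2 - 2 * t - 1 = 0.
Hypothesis h1 :
    2 * x1 ^+ 2 + 4 * x2 * x1 - 2 * x3 * x1 - 3 * x4 * x1 - 3 * x5 * x1
    + x2 ^+ 2 + x4 ^+ 2 + 2 * x5 ^+ 2 + 2 * x2 * x3
    - 5 * x2 * x4 + 2 * x3 * x4 - 3 * x2 * x5 - 2 * x3 * x5 + 4 * x4 * x5
    = 0.
Hypothesis h2 :
    2 * x1 ^+ 2 + x2 * x1 - 3 * x3 * x1 + x4 * x1 - 3 * x5 * x1
    - x2 ^+ 2 + x3 ^+ 2 - x4 ^+ 2 + 2 * x5 ^+ 2
    + 2 * x2 * x3 - 2 * x2 * x4 + 2 * x3 * x4 + x2 * x5 - 3 * x3 * x5 + x4 * x5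
    = 0.
Hypothesis h3 :
    x1 ^+ 3 + 2 * x2 * x1 ^+ 2 + 4 * x3 * x1 ^+ 2 + 2 * x4 * x1 ^+ 2
    + 3 * x5 * x1 ^+ 2 - x2 ^+ 2 * x1 + 3 * x3 ^+ 2 * x1 - x4 ^+ 2 * x1
    + 3 * x5 ^+ 2 * x1 + 3 * x2 * x3 * x1 - 2 * x2 * x4 * x1
    + 3 * x3 * x4 * x1 + 4 * x2 * x5 * x1 - 41 * x3 * x5 * x1
    + 4 * x4 * x5 * x1 - x2 ^+ 3 - x3 ^+ 3 - x4 ^+ 3 + x5 ^+ 3
    + 2 * x2 * x3 ^+ 2 - 3 * x2 * x4 ^+ 2 + x3 * x4 ^+ 2
    + 2 * x2 * x5 ^+ 2 + 4 * x3 * x5 ^+ 2 + 2 * x4 * x5 ^+ 2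
    + x2 ^+ 2 * x3 - 3 * x2 ^+ 2 * x4 + 2 * x3 ^+ 2 * x4 + 2 * x2 * x3 * x4
    - x2 ^+ 2 * x5 + 3 * x3 ^+ 2 * x5 - x4 ^+ 2 * x5
    + 3 * x2 * x3 * x5 - 2 * x2 * x4 * x5 + 3 * x3 * x4 * x5
    = 0.

Let mod_t (a c u : R) :
  a = c + u * (t ^+ 3 + t ^+ 2 - 2 * t - 1) -> a = c.
Proof. by rewrite ht mulr0 addr0. Qed.

Lemma match6_splits7 : match6_splits x1 x2 x3 x4 x5 height7 slope7.
Proof.
pose g j := slope7 j; pose b j := height7 j.
(* [cpq] gives the coefficient of s^p tau^q in the elementary symmetric function of degree p + q.
   The values 5, 6, 1 count the matchings of a path with five edges, by size. *)
have c01 : g 0%N + g 1%N + g 2%N = 5 by rewrite /g /slope7 /=; ring.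
have c02 : g 0%N * g 1%N + g 0%N * g 2%N + g 1%N * g 2%N = 6.
  by apply: (@mod_t _ _ (- t)); rewrite /g /slope7 /=; ring.
have c03 : g 0%N * g 1%N * g 2%N = 1.
  by apply: (@mod_t _ _ (- t ^+ 2 - 2 * t + 1)); rewrite /g /slope7 /=; ring.
have c10 : b 0%N + b 1%N + b 2%N = x1 + x2 + x3 + x4 + x5.
  by rewrite /b /height7 /= /p /q /r; field.
have c11 : b 0%N * (g 1%N + g 2%N) + b 1%N * (g 0%N + g 2%N)
    + b 2%N * (g 0%N + g 1%N) = 3 * x1 + 2 * x2 + 2 * x3 + 2 * x4 + 3 * x5.
  apply: (@mod_t _ _ ((- t * p - 4 * t * q - 4 * t * r) / 7)).
  by rewrite /b /height7 /= /p /q /r /g /slope7 /=; field.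
have c12 : b 0%N * g 1%N * g 2%N + b 1%N * g 0%N * g 2%N
    + b 2%N * g 0%N * g 1%N = x1 + x3 + x5.
  apply: (@mod_t _ _ (( t ^+ 3 * p - 2 * t ^+ 3 * r - t ^+ 2 * p - 6 * t ^+ 2
    * q - 7 * t ^+ 2 * r - 9 * t * p - 11 * t * q - 2 * t * r + p + 6 * q + 7
    * r ) / 7)).
  by rewrite /b /height7 /= /p /q /r /g /slope7 /=; field.
have c20 : b 0%N * b 1%N + b 0%N * b 2%N + b 1%N * b 2%N =
    x1 * x3 + x1 * x4 + x1 * x5 + x2 * x4 + x2 * x5 + x3 * x5.
  apply: (@mod_t _ _ (( - t * p ^+ 2 - 2 * t * p * q + t * p * r - 4 * t * q ^+
    2 - 8 * t * q * r - 7 * t * r ^+ 2 ) / 49)).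
  (* The two sides differ by 1/7 of [h1], up to a multiple of the minimal polynomial; [h2] and [h3]
     enter below with factors 1/7 and 1/49. *)
  rewrite -[RHS]addr0 -[in RHS](mulr0 7^-1) -h1.
  by rewrite /b /height7 /= /p /q /r; field.
have c21 : b 0%N * b 1%N * g 2%N + b 0%N * b 2%N * g 1%N + b 1%N * b 2%N * g 0%N
  =
    x1 * x3 + x1 * x5 + x3 * x5.
  apply: (@mod_t _ _ (( t ^+ 3 * p ^+ 2 + 4 * t ^+ 3 * p * q + 2 * t ^+ 3 * p
    * r - 8 * t ^+ 3 * q * r - 8 * t ^+ 3 * r ^+ 2 + 2 * t ^+ 2 * p ^+ 2 - 4 *
    t ^+ 2 * p * q - 14 * t ^+ 2 * p * r - 12 * t ^+ 2 * q ^+ 2 - 28 * t ^+ 2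
    * q * r - 7 * t ^+ 2 * r ^+ 2 - 8 * t * p ^+ 2 - 35 * t * p * q - 24 * t *
    p * r - 20 * t * q ^+ 2 - 4 * t * q * r + 14 * t * r ^+ 2 - 2 * p ^+ 2 + 4
    * p * q + 14 * p * r + 12 * q ^+ 2 + 28 * q * r + 7 * r ^+ 2 ) / 49)).
  rewrite -[RHS]addr0 -[in RHS](mulr0 7^-1) -h2.
  by rewrite /b /height7 /= /p /q /r /g /slope7 /=; field.
have c30 : b 0%N * b 1%N * b 2%N = x1 * x3 * x5.
  apply: (@mod_t _ _ (( 2 * t ^+ 3 * p ^+ 2 * q + 3 * t ^+ 3 * p ^+ 2 * r + 4
    * t ^+ 3 * p * q ^+ 2 + 4 * t ^+ 3 * p * q * r - 3 * t ^+ 3 * p * r ^+ 2 -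
    8 * t ^+ 3 * q ^+ 2 * r - 16 * t ^+ 3 * q * r ^+ 2 - 6 * t ^+ 3 * r ^+ 3 +
    t ^+ 2 * p ^+ 3 + 4 * t ^+ 2 * p ^+ 2 * q - 4 * t ^+ 2 * p * q ^+ 2 - 28 *
    t ^+ 2 * p * q * r - 21 * t ^+ 2 * p * r ^+ 2 - 8 * t ^+ 2 * q ^+ 3 - 28 *
    t ^+ 2 * q ^+ 2 * r - 14 * t ^+ 2 * q * r ^+ 2 + 7 * t ^+ 2 * r ^+ 3 - 2 *
    t * p ^+ 3 - 15 * t * p ^+ 2 * q - 14 * t * p ^+ 2 * r - 34 * t * p * q ^+
    2 - 49 * t * p * q * r - 7 * t * p * r ^+ 2 - 12 * t * q ^+ 3 + 35 * t * q
    * r ^+ 2 + 14 * t * r ^+ 3 - p ^+ 3 - 4 * p ^+ 2 * q + 4 * p * q ^+ 2 + 28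
    * p * q * r + 21 * p * r ^+ 2 + 8 * q ^+ 3 + 28 * q ^+ 2 * r + 14 * q * r
    ^+ 2 - 7 * r ^+ 3 ) / 343)).
  rewrite -[RHS]addr0 -[in RHS](mulr0 49^-1) -h3.
  by rewrite /b /height7 /= /p /q /r; field.
move=> T f s tau z; rewrite !big_ord_recl big_ord0 mulr1 /= /bump /= -/(b _)
  -/(g _).
rewrite -/(b 0%N) -/(b 1%N) -/(b 2%N) -/(g 0%N) -/(g 1%N) -/(g 2%N).
move: (b 0%N) (b 1%N) (b 2%N) (g 0%N) (g 1%N) (g 2%N) c01 c02 c03 c10 c11 c12
  c20 c21 c30.
move=> b0 b1 b2 g0 g1 g2.
move=> /(congr1 f) c01 /(congr1 f) c02 /(congr1 f) c03.
move=> /(congr1 f) c10 /(congr1 f) c11 /(congr1 f) c12.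
move=> /(congr1 f) c20 /(congr1 f) c21 /(congr1 f) c30.
move: c01 c02 c03 c10 c11 c12 c20 c21 c30.
rewrite !(rmorphD, rmorphM, rmorph1, rmorph_nat).
move: (f b0) (f b1) (f b2) (f g0) (f g1) (f g2) => B0 B1 B2 G0 G1 G2.
move=> c01 c02 c03 c10 c11 c12 c20 c21 c30.
transitivity (z ^+ 3 - ((B0 + B1 + B2) * s + (G0 + G1 + G2) * tau) * z ^+ 2
 + ((B0 * B1 + B0 * B2 + B1 * B2) * s ^+ 2
   + (B0 * (G1 + G2) + B1 * (G0 + G2) + B2 * (G0 + G1)) * s * tau
   + (G0 * G1 + G0 * G2 + G1 * G2) * tau ^+ 2) * z
 - ((B0 * B1 * B2) * s ^+ 3
   + (B0 * B1 * G2 + B0 * B2 * G1 + B1 * B2 * G0) * s ^+ 2 * tau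
   + (B0 * G1 * G2 + B1 * G0 * G2 + B2 * G0 * G1) * s * tau ^+ 2
   + G0 * G1 * G2 * tau ^+ 3)); last by ring.
by rewrite c01 c02 c03 c10 c11 c12 c20 c21 c30 /match6; ring.
Qed.
End Splitting.

(** * Cosines of the multiples of pi / 7 *)

Section Angles.
Variable R : realType.
Definition dcos7 (j : nat) : R := 2 * cos (j%:R * pi / 7).

Lemma dcos7_double j : dcos7 j ^+ 2 = 2 + dcos7 (j.*2).
Proof.
rewrite /dcos7; have -> : j.*2%:R * pi / 7 = (j%:R * pi / 7) *+ 2 :> R.
  by rewrite -muln2 natrM; ring.
by rewrite cos_mulr2n; ring.
Qed.

Lemma dcos7_gt i j : (i < j <= 7)%N -> dcos7 j < dcos7 i.
Proof.
move=> ij; rewrite /dcos7 ltr_pM2l // ltr_cos ?in_itv /=.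
- by rewrite !ltr_pM2r ?invr_gt0 ?pi_gt0 ?ltr_nat //; lia.
- rewrite !mulr_ge0 ?invr_ge0 ?pi_ge0 //= ler_pdivrMr // mulrC ler_pM2l ?pi_gt0
    //.
  by rewrite ler_nat; lia.
- rewrite !mulr_ge0 ?invr_ge0 ?pi_ge0 //= ler_pdivrMr // mulrC ler_pM2l ?pi_gt0
    //.
  by rewrite ler_nat; lia.
Qed.

Lemma dcos7_gt0 j : (j <= 3)%N -> 0 < dcos7 j.
Proof.
move=> j3; rewrite mulr_gt0 // cos_gt0_pihalf //; apply/andP; split.
  apply: (@lt_le_trans _ _ 0); first by rewrite oppr_lt0 divr_gt0 ?pi_gt0.
  by rewrite !mulr_ge0 ?invr_ge0 ?pi_ge0.
rewrite mulrAC mulrC ltr_pM2l ?pi_gt0 // ltr_pdivrMr //.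
have : j%:R <= 3 :> R by rewrite ler_nat.
lra.
Qed.

Lemma dcos7_6 : dcos7 6 = dcos7 2 ^+ 3 - 3 * dcos7 2.
Proof.
rewrite /dcos7; have -> : 6 * pi / 7 = 4 * pi / 7 + 2 * pi / 7 :> R by ring.
have -> : 4 * pi / 7 = (2 * pi / 7) *+ 2 :> R by ring.
rewrite cosD cos_mulr2n sin_mulr2n.
have := sin2cos2 (2 * pi / 7 : R); set sn := sin _; set cs := cos _ => E.
transitivity (2 * ((cs ^+ 2 *+ 2 - 1) * cs - 2 * cs * sn ^+ 2)); first by ring.
by rewrite E; ring.
Qed.

(** [dcos7 6] and [dcos7 8] are polynomials in [dcos7 2], and they coincide since 8 pi / 7 = 2 pi -
    6 pi / 7. The factor [dcos7 2 - 2] of their difference is nonzero. *)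
Lemma dcos7_min_poly : dcos7 2 ^+ 3 + dcos7 2 ^+ 2 - 2 * dcos7 2 - 1 = 0.
Proof.
have c4 : dcos7 4 = dcos7 2 ^+ 2 - 2 by rewrite (dcos7_double 2); ring.
have c8 : dcos7 8 = dcos7 4 ^+ 2 - 2 by rewrite (dcos7_double 4); ring.
have c6 : dcos7 6 = dcos7 8.
  rewrite /dcos7; congr (2 * _); rewrite -[RHS]cosN -[RHS]cosD2pi; congr cos.
  by field.
have : (dcos7 2 - 2) * (dcos7 2 ^+ 3 + dcos7 2 ^+ 2 - 2 * dcos7 2 - 1) = 0.
  move: c6; rewrite dcos7_6 c8 c4 => /eqP; rewrite eq_sym -subr_eq0 => /eqP <-;
    ring.
move/eqP; rewrite mulf_eq0 => /orP[|/eqP //].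
have : dcos7 2 < 2.
  by have := @dcos7_gt 0 2 isT; rewrite {2}/dcos7 !mul0r cos0 mulr1.
by move=> h; rewrite subr_eq0 lt_eqF.
Qed.

Lemma slope7_dcos7 j : (j < 3)%N -> slope7 (dcos7 2) j = dcos7 j.+1 ^+ 2.
Proof.
case: j => [|[|[|]]] // _; rewrite /slope7 /=.
- by rewrite (dcos7_double 1).
rewrite (dcos7_double 3) dcos7_6; have := dcos7_min_poly.
by move=> h; apply/eqP; rewrite -subr_eq0 -oppr_eq0 -h; apply/eqP; ring.
Qed.
End Angles.

(** * Sign and order of the heights *)

Section Order.
Variable R : realFieldType.
Variables (x1 x2 x3 x4 x5 : R) (b g : nat -> R).
Hypothesis split : match6_splits x1 x2 x3 x4 x5 b g.
Hypotheses (x1_ge0 : 0 <= x1) (x2_ge0 : 0 <= x2) (x3_ge0 : 0 <= x3)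
  (x4_ge0 : 0 <= x4) (x5_ge0 : 0 <= x5).

(** At s = 1, tau = 0 the heights are roots of a cubic with coefficients of alternating signs, which
    is negative at negative arguments. *)
Lemma splits_height_ge0 j : (j < 3)%N -> 0 <= b j.
Proof.
move=> j3; have := split idfun 1 0 (b j).
rewrite (bigD1 (Ordinal j3)) //= !mulr1 !mulr0 !addr0 subrr mul0r.
rewrite /match6 => E; rewrite leNgt; apply/negP => b_lt0.
have b2 : 0 < b j ^+ 2 by rewrite exprn_even_gt0 //= lt_eqF.
have b3 : b j ^+ 3 < 0 by rewrite exprSr pmulr_rlt0.
move: E; apply/eqP; rewrite lt_eqF //.
set s1 := (X in _ - X * _ + _ - _); set s2 := (X in _ + X * _ - _).
have s1b : 0 <= s1 * b j ^+ 2 by rewrite mulr_ge0 ?(ltW b2) // !addr_ge0.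
have s2b : s2 * b j <= 0.
  by rewrite mulr_ge0_le0 ?(ltW b_lt0) // !(addr_ge0, mulr_ge0).
have s3 : 0 <= x1 * x3 * x5 by rewrite !mulr_ge0.
by move: b3 s1b s2b s3; lra.
Qed.

(* match6 is monic of degree 3 in z, so the left-hand side is 2 P'(z) + 2.  The
   Wronskian P' Q - P Q' with a principal minor Q is positive. *)
Lemma match6_simple_root (w1 w2 w3 w4 w5 z : R) :
  0 < w1 -> 0 < w2 -> 0 < w3 -> 0 < w4 -> 0 < w5 ->
  match6 w1 w2 w3 w4 w5 z = 0 ->
  match6 w1 w2 w3 w4 w5 (z + 1) - match6 w1 w2 w3 w4 w5 (z - 1) != 2.
Proof.
move=> w1P w2P w3P w4P w5P P0; apply/eqP => P1.
(* [match6] is the characteristic polynomial of the Jacobi matrix with diagonal [w1], [w2 + w3],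
   [w4 + w5] and off-diagonal products [w1 * w2], [w3 * w4]; [Q] and [u] are its trailing minors. *)
pose u := z - w4 - w5; pose Q := (z - w2 - w3) * u - w3 * w4.
pose Q' := (z - w2 - w3) + u.
pose P' := Q + (z - w1) * Q' - w1 * w2.
have P'0 : 2 * P' = 0.
  by rewrite -[RHS](subrr 2) -[X in _ = X - _]P1 /P' /Q' /Q /u /match6; ring.
have : P' * Q - match6 w1 w2 w3 w4 w5 z * Q'
    = Q ^+ 2 + w1 * w2 * (u ^+ 2 + w3 * w4).
  by rewrite /P' /Q' /Q /u /match6; ring.
have -> : P' = 0 by lra.
rewrite P0 !mul0r subr0 => /eqP; rewrite lt_eqF //.
by rewrite ltr_wpDl ?sqr_ge0 // !mulr_gt0 // ltr_wpDl ?sqr_ge0 // mulr_gt0.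
Qed.

(* If two of the lines b + g tau crossed at some tau > 0, match6 would have a
   double root there. *)
Lemma splits_height_mono i j : (i < j < 3)%N -> g j < g i -> b j <= b i.
Proof.
move=> ij gij; rewrite leNgt; apply/negP => bij.
pose tau := (b j - b i) / (g i - g j).
have tau0 : 0 < tau by rewrite divr_gt0 // subr_gt0.
pose z := b i + g i * tau.
have zj : z = b j + g j * tau.
  by rewrite /z /tau; field; lra.
have [e E] : exists e, forall y, match6 (x1 + tau) (x2 + tau) (x3 + tau) (x4 +
  tau) (x5 + tau) y
     = (y - z) ^+ 2 * (y - e).
  have E y := split idfun 1 tau y.
  move: E; rewrite /= !mulr1 => E.
  have i3 : (i < 3)%N by lia.
  have j3 : (j < 3)%N by lia.
  (* The three indices sum to 3. *)
  have [k k3 [ki kj]] : exists2 k, (k < 3)%N & k <> i /\ k <> j.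
    by exists (3 - i - j)%N; [lia | lia].
  exists (b k + g k * tau) => y; rewrite E.
  rewrite (bigD1 (Ordinal i3)) //= (bigD1 (Ordinal j3)) /=; last first.
    by rewrite -val_eqE /=; lia.
  rewrite (bigD1 (Ordinal k3)) /=; last by rewrite -!val_eqE /=; lia.
  rewrite big1 ?mulr1 => [|l]; last by case: l => l ll; rewrite -!val_eqE /=;
    lia.
  by rewrite -zj -/z; ring.
have pos y : 0 <= y -> 0 < y + tau by move=> y0; rewrite ltr_wpDl.
have P0 := E z; rewrite subrr expr0n mul0r in P0.
(* At the double root the increment is (z + 1 - e) - (z - 1 - e) = 2, which [match6_simple_root]
   excludes. *)
have := match6_simple_root (pos _ x1_ge0) (pos _ x2_ge0) (pos _ x3_ge0)
  (pos _ x4_ge0) (pos _ x5_ge0) P0.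
by rewrite !E => /eqP; apply; ring.
Qed.
End Order.

(** * Ellipses and their support functions *)

Section Disk.
Local Open Scope complex_scope.
Variable R : realType.
Local Notation Re := (@complex.Re _).
Local Notation Im := (@complex.Im _).

(* The right-hand side says that z satisfies every inequality given by the
   support function of the ellipse. *)
Lemma elliptical_diskP (z : R[i]) (c b : R) :
  elliptical_disk c%:C (- c)%:C b z <->
  (forall u v, (Re z * u + Im z * v) ^+ 2 <= (b ^+ 2 + c ^+ 2) * u ^+ 2 + b ^+ 2
    * v ^+ 2).
Proof.
case: z => x y; rewrite /elliptical_disk /=.
rewrite !oppr0 !addr0 opprK.
have -> : (Num.sqrt ((c + c) ^+ 2 + 0 ^+ 2) / 2) ^+ 2 = c ^+ 2.
  by rewrite expr0n addr0 expr_div_n sqr_sqrtr ?sqr_ge0 //; field.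
set al := b ^+ 2 + c ^+ 2; set be := b ^+ 2.
have be0 : 0 <= be by exact: sqr_ge0.
have al0 : 0 <= al by rewrite addr_ge0 ?sqr_ge0.
have c2 : c ^+ 2 = al - be by rewrite /al /be; ring.
set p := (x - c) ^+ 2 + _; set q := (x + c) ^+ 2 + _.
have p0 : 0 <= p by rewrite addr_ge0 ?sqr_ge0.
have q0 : 0 <= q by rewrite addr_ge0 ?sqr_ge0.
have pq : p + q = 2 * (x ^+ 2 + y ^+ 2 + c ^+ 2) by rewrite /p /q; ring.
have step1 : (Num.sqrt p + Num.sqrt q <= 2 * Num.sqrt al) =
    (2 * Num.sqrt (p * q) <= 4 * al - (p + q)).
  have sp := sqrtr_ge0 p; have sq := sqrtr_ge0 q; have sa := sqrtr_ge0 al.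
  transitivity ((Num.sqrt p + Num.sqrt q) ^+ 2 <= (2 * Num.sqrt al) ^+ 2).
    by rewrite ler_sqr ?nnegrE ?addr_ge0 ?mulr_ge0.
  rewrite exprMn sqrrD !sqr_sqrtr // sqrtrM // -mulr_natl.
  by apply/idP/idP; lra.
(* The condition [p + q <= 4 * al] keeps the sign lost in squaring; it is what bounds the segment
   when [be = 0]. *)
have step2 : (2 * Num.sqrt (p * q) <= 4 * al - (p + q)) <->
    (p + q <= 4 * al /\ be * x ^+ 2 + al * y ^+ 2 <= al * be).
  have E : (4 * al - (p + q)) ^+ 2 - (2 * Num.sqrt (p * q)) ^+ 2 =
      16 * (al * be - (be * x ^+ 2 + al * y ^+ 2)).
    by rewrite exprMn sqr_sqrtr ?mulr_ge0 // pq /p /q /al /be; ring.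
  split=> [le|[le1 le2]].
    have le1 : 0 <= 4 * al - (p + q).
      by apply: le_trans le; rewrite mulr_ge0 ?sqrtr_ge0.
    split; first by lra.
    move: le; rewrite -ler_sqr ?nnegrE ?mulr_ge0 ?sqrtr_ge0 // => le.
    by move: E le; lra.
  rewrite -ler_sqr ?nnegrE ?mulr_ge0 ?sqrtr_ge0 //; last by lra.
  by move: E le2; lra.
rewrite step1 step2 pq c2; split=> [[le1 le2] u v | le].
  have [be_gt0|be_eq0] : 0 < be \/ be = 0 by move: be0; rewrite le_eqVlt =>
    /orP[/eqP <-|->]; [right|left].
    have al_gt0 : 0 < al by rewrite /al ltr_pwDl ?sqr_ge0.
    have ab : 0 < al * be by rewrite mulr_gt0.
    rewrite -(ler_pM2l ab).
    apply: (@le_trans _ _ ((be * x ^+ 2 + al * y ^+ 2) * (al * u ^+ 2 + be * v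
      ^+ 2))).
      rewrite -subr_ge0.
      have -> : (be * x ^+ 2 + al * y ^+ 2) * (al * u ^+ 2 + be * v ^+ 2)
         - al * be * (x * u + y * v) ^+ 2 = (be * x * v - al * y * u) ^+ 2 by
             ring.
      exact: sqr_ge0.
    by rewrite ler_wpM2r // addr_ge0 // mulr_ge0 ?sqr_ge0 // ltW.
  move: le1 le2; rewrite be_eq0 mul0r mulr0 !add0r subr0 => le1 le2.
  have [al_gt0|al_eq0] : 0 < al \/ al = 0 by move: al0; rewrite le_eqVlt =>
    /orP[/eqP <-|->]; [right|left].
    have y2 : y ^+ 2 <= 0 by rewrite -(ler_pM2l al_gt0) mulr0.
    have y0 : y = 0 by apply/eqP; rewrite -sqrf_eq0 eq_le y2 sqr_ge0.
    rewrite y0 !mul0r !addr0 exprMn ler_wpM2r ?sqr_ge0 //.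
    by move: le1; rewrite y0; lra.
  have x2 := sqr_ge0 x; have y2 := sqr_ge0 y.
  have /eqP : x ^+ 2 = 0 by move: le1; rewrite al_eq0; lra.
  have /eqP : y ^+ 2 = 0 by move: le1; rewrite al_eq0; lra.
  by rewrite !sqrf_eq0 => /eqP-> /eqP->; rewrite al_eq0 !mul0r addr0 expr0n.
(* The direction of [le3] is normal, at (x, y), to the homothetic ellipse through that point; it
   turns the hypothesis into Q^2 <= al be Q. *)
have le1 := le 1 0; have le2 := le 0 1; have le3 := le (be * x) (al * y).
split; first by move: le1 le2; lra.
set Q := be * x ^+ 2 + al * y ^+ 2.
have Q0 : 0 <= Q by rewrite addr_ge0 // mulr_ge0 ?sqr_ge0.
have QQ : Q * Q <= al * be * Q.
  have -> : Q * Q = (x * (be * x) + y * (al * y)) ^+ 2 by rewrite /Q; ring.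
  by apply: le_trans le3 _; rewrite /Q le_eqVlt; apply/orP; left; apply/eqP;
    ring.
move: Q0; rewrite le_eqVlt => /orP[/eqP <-|Q0]; first by rewrite mulr_ge0.
by move: QQ; rewrite ler_pM2r.
Qed.
End Disk.

(** * Determinants of reciprocal matrices *)

Section Quadratic.
Variable R : realType.
Local Notation toC := (real_complex R).
Local Notation Re := (@complex.Re R).
Local Notation Im := (@complex.Im R).

Lemma conj_toC (x : R) : (toC x)^* = toC x.
Proof. exact: conjc_real. Qed.

Lemma mul_conjC (z : R[i]) : z * z^* = toC (Re z ^+ 2 + Im z ^+ 2).
Proof. by rewrite -normCK -add_Re2_Im2. Qed.

(* Each factor of det (M^* + X M), for M = A - z, has this shape. *)
Definition quad_pencil (z : R[i]) (bp g : R) : {poly R[i]} :=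
  (z^*%:P + z%:P * 'X) ^+ 2 - (toC (4 * bp))%:P * 'X - (toC g)%:P * (1 + 'X) ^+
    2.

(** Otherwise the values at 0, 1 and -1 give z^2 = g, so that z^* + z and z^* - z have product zero,
    while their squares multiply to -16 bp (bp + g). *)
Lemma quad_pencil_neq0 z bp g : 0 < bp -> 0 <= g -> quad_pencil z bp g != 0.
Proof.
move=> bp0 g0; apply/eqP => q0.
have ev a : (z^* + z * a) ^+ 2 - toC (4 * bp) * a - toC g * (1 + a) ^+ 2 = 0.
  by have := congr1 (fun p => p.[a]) q0; rewrite /quad_pencil !hornerE.
have z'2 : (z^*) ^+ 2 = toC g.
  by have := ev 0; rewrite !mulr0 !addr0 subr0 expr1n mulr1 => /subr0_eq.
have z2 : z ^+ 2 = toC g by rewrite -[z]conjCK -rmorphXn /= z'2 conj_toC.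
have : toC (16 * bp * (bp + g)) = 0.
  have e1 : (z^* + z) ^+ 2 = toC (4 * bp + 4 * g).
    have := ev 1; rewrite !mulr1 => /eqP; rewrite subr_eq0 subr_eq => /eqP ->.
    by rewrite rmorphD !rmorphM /= !(rmorph_nat toC); ring.
  have e2 : (z^* - z) ^+ 2 = - toC (4 * bp).
    have := ev (-1); rewrite subrr expr0n mulr0 subr0 !mulrN1 opprK => /eqP.
    by rewrite addr_eq0 => /eqP.
  transitivity (- ((z^* + z) ^+ 2 * (z^* - z) ^+ 2)).
    by rewrite e1 e2 !rmorphM !rmorphD !rmorphM /= !(rmorph_nat toC); ring.
  have -> : (z^* + z) ^+ 2 * (z^* - z) ^+ 2 = (z^* ^+ 2 - z ^+ 2) ^+ 2 by ring.
  by rewrite z'2 z2 subrr expr0n oppr0.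
apply/eqP; rewrite fmorph_eq0; apply: lt0r_neq0.
by rewrite !mulr_gt0 // ltr_wpDr.
Qed.

(* Dividing by X on the unit circle, the quadratic is a negative function: z is
   strictly inside the ellipse of minor half-axis sqrt bp. *)
Lemma quad_pencil_factor z bp g :
  Re z ^+ 2 + Im z ^+ 2 < 2 * bp + g ->
  bp * Re z ^+ 2 + (bp + g) * Im z ^+ 2 < (bp + g) * bp ->
  exists m : R[i], exists2 k : R[i], k != 0 & `|m| != 1 /\
    quad_pencil z bp g = k *: (('X - m%:P) * (1 - m^* *: 'X)).
Proof.
set x := Re z; set y := Im z => lt1 lt2.
(* The quadratic is al X^2 + kap X + al^*, with al = z^2 - g; [n2] is the squared modulus of al and
   [D] the discriminant. *)
pose kap := 2 * (x ^+ 2 + y ^+ 2) - 4 * bp - 2 * g.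
pose n2 := (x ^+ 2 - y ^+ 2 - g) ^+ 2 + 4 * x ^+ 2 * y ^+ 2.
pose D := kap ^+ 2 - 4 * n2.
have kap0 : kap < 0 by rewrite /kap; lra.
have D0 : 0 < D.
  have -> : D = 16 * ((bp + g) * bp - (bp * x ^+ 2 + (bp + g) * y ^+ 2)).
    by rewrite /D /kap /n2; ring.
  by rewrite mulr_gt0 // subr_gt0.
have sD : 0 < Num.sqrt D by rewrite sqrtr_gt0.
have den : kap - Num.sqrt D < 0 by lra.
(* The root - t al^* is the form of the quadratic formula without division by al, which may
   vanish. *)
pose t := 2 / (kap - Num.sqrt D).
have t0 : t != 0 by rewrite /t mulf_eq0 invr_eq0 (lt_eqF den) orbF pnatr_eq0.
have tE : 1 + t ^+ 2 * n2 = t * kap.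
  have n2E : n2 = (kap ^+ 2 - Num.sqrt D ^+ 2) / 4.
    by rewrite sqr_sqrtr ?(ltW D0) // /D; field.
  by rewrite /t n2E; field; lra.
pose al := z ^+ 2 - toC g.
have alE : al * al^* = toC n2.
  rewrite mul_conjC; congr (toC _).
  by rewrite /al /n2 /x /y; case: (z) => a b /=; ring.
pose m := - (toC t * al^*).
have mC : m^* = - (toC t * al) by rewrite /m rmorphN rmorphM /= conjCK conj_toC.
exists m; exists (toC t)^-1; first by rewrite invr_eq0 fmorph_eq0.
split.
  apply/eqP => /(congr1 (fun v => v ^+ 2)); rewrite expr1n normCK mC /m.
  have -> : - (toC t * al^*) * - (toC t * al) = toC t ^+ 2 * (al * al^*) by
    ring.
  rewrite alE -rmorphXn -rmorphM /= -[1](rmorph1 toC) => /complexI E.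
  have t2 : t * kap = 2 by rewrite -tE E.
  have : kap = kap - Num.sqrt D.
    apply: (mulfI t0); rewrite t2 /t; field; lra.
  by lra.
apply: (canRL (scalerK _)); first by rewrite fmorph_eq0.
have zz := mul_conjC z; rewrite -/x -/y in zz.
have kE : toC t * (2 * (z * z^*) - toC (4 * bp) - 2 * toC g) = 1 + toC t ^+ 2 *
  (al * al^*).
  have -> : 2 * (z * z^*) - toC (4 * bp) - 2 * toC g = toC kap.
    by rewrite zz /kap !(rmorphB toC) !(rmorphM toC) !(rmorph_nat toC).
  by rewrite alE -(rmorphXn toC) -!(rmorphM toC) -[1](rmorph1 toC) -(rmorphD
    toC) tE.
rewrite mC /m -!mul_polyC.
transitivity ((toC t * al)%:P * 'X ^+ 2 + (toC t * (2 * (z * z^*) - toC (4 * bp)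
  - 2 * toC g))%:P * 'X + (toC t * al^*)%:P).
  have -> : al^* = (z^*) ^+ 2 - toC g.
    by rewrite /al rmorphB rmorphXn /= conj_toC.
  rewrite /quad_pencil /al.
  move: (toC t) (toC (4 * bp)) (toC g) (z^*) => t' b' g' z'.
  ring.
rewrite kE; move: (al^*) (toC t) => al' t'; ring.
Qed.
End Quadratic.

Section Tridiagonal.
Variable R : realType.
Local Notation C := R[i].
Local Notation toC := (real_complex R).

(* Since |A i j| |A j i| = 1, the last equation says that the parameter of
   index i + 1 is y i. *)
Definition reciprocal_with (A : 'M[C]_6) (y : nat -> R) : Prop :=
  (forall i j : 'I_6, i.+1 != j -> j.+1 != i -> A i j = 0) /\
  (forall i j : 'I_6, i.+1 = j -> A i j * A j i = 1 /\
     `|A i j| ^+ 2 + `|A j i| ^+ 2 = toC (4 * y i + 2)).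

(** For entries a, c with a c = 1, the product of al a + be c^* and al c + be a^* is al^2 + be^2 +
    al be (|a|^2 + |c|^2). Polynomial coefficients cover both the characteristic polynomial and the
    pencil. *)
Lemma det_reciprocal (A : 'M[C]_6) (y : nat -> R) (d al be : {poly C}) :
  reciprocal_with A y ->
  let w k := (toC (y k))%:P * (4 * (al * be)) + (al + be) ^+ 2 in
  \det (d%:M + al *: map_mx polyC A + be *: map_mx polyC (A^t*)) =
  match6 (w 0%N) (w 1%N) (w 2%N) (w 3%N) (w 4%N) (d ^+ 2).
Proof.
move=> [A0 A1] w.
pose h i j := al * (A (inord i) (inord j))%:P + be * ((A (inord j) (inord
  i))^*)%:P.
pose f (i j : nat) : {poly C} :=
  if i == j then d else if (i.+1 == j) || (j.+1 == i) then h i j else 0.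
have -> : d%:M + al *: map_mx polyC A + be *: map_mx polyC (A^t*) =
    \matrix_(i < 6, j < 6) f i j.
  apply/matrixP => i j; rewrite !mxE /f /h !inord_val -val_eqE /=.
  case: eqVneq => [ij|_].
    by rewrite !A0 ?ij ?conjC0 ?mulr0 ?addr0 // -ij; lia.
  case: ifPn => [_|]; first by rewrite mulr0n add0r.
  by rewrite negb_or => /andP[ij ji]; rewrite !A0 // conjC0 polyC0 !mulr0
    !addr0.
rewrite (@det_tridiag6 _ f d) => [|i j|i]; last 2 first.
- by rewrite /f => /negPf-> /negPf-> /negPf->.
- by rewrite /f eqxx.
have fw k : (k < 5)%N -> f k k.+1 * f k.+1 k = w k.
  move=> k5; rewrite /f !eqxx (ltn_eqF (ltnSn k)) (gtn_eqF (ltnSn k)) orbT /=.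
  have [|ab1 ab2] := A1 (inord k) (inord k.+1).
    by rewrite !inordK //; lia.
  rewrite inordK in ab2; last by lia.
  rewrite /h; move: (A _ _) (A _ _) ab1 ab2 => b a ab1 ab2.
  transitivity (al ^+ 2 * (a * b)%:P + be ^+ 2 * ((a * b)^*)%:P
     + al * be * (`|a| ^+ 2 + `|b| ^+ 2)%:P).
    by rewrite !normCK rmorphM /=; ring.
  rewrite ab1 ab2 conjC1 polyC1 /w rmorphD rmorphM /= !(rmorph_nat toC); ring.
by rewrite !fw.
Qed.

Variables (x b g : nat -> R).
Hypothesis split : match6_splits (x 0%N) (x 1%N) (x 2%N) (x 3%N) (x 4%N) b g.

(** Here s = 4 al be. The shift [e] of the parameters is absorbed into tau: it turns [b j] into
    [b j + g j * e] and keeps the slopes. *)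
Lemma det_reciprocal_split (A : 'M[C]_6) e (d al be : {poly C}) :
  reciprocal_with A (fun k => x k + e) ->
  \det (d%:M + al *: map_mx polyC A + be *: map_mx polyC (A^t*)) =
  \prod_(j < 3) (d ^+ 2 - ((toC (b j))%:P * (4 * (al * be))
    + (toC (g j))%:P * ((toC e)%:P * (4 * (al * be)) + (al + be) ^+ 2))).
Proof.
move=> /det_reciprocal -> /=.
rewrite -(split (polyC \o toC)) /=.
by congr match6; rewrite !rmorphD /=; ring.
Qed.

(** The matrix is u Re A + v Im A; the values 4 al al^* = u^2 + v^2 and al + al^* = u give s and tau
    = u^2. *)
Lemma char_poly_reciprocal (A : 'M[C]_6) (u v : R) : 
  reciprocal_with A x ->
  let al := toC (u / 2) - 'i * toC (v / 2) in
  char_poly (al *: A + al^* *: A^t*) =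
  \prod_(j < 3) ('X ^+ 2 - (toC ((b j + g j) * u ^+ 2 + b j * v ^+ 2))%:P).
Proof.
move=> rA al.
have rA0 : reciprocal_with A (fun k => x k + 0).
  by case: rA => A0 A1; split=> // i j /A1; rewrite addr0.
rewrite /char_poly /char_poly_mx.
have -> : 'X%:M - map_mx polyC (al *: A + al^* *: A^t*) =
  'X%:M + (- al%:P) *: map_mx polyC A + (- (al^*)%:P) *: map_mx polyC (A^t*).
  by rewrite map_mxD !map_mxZ opprD !scaleNr addrA.
rewrite (det_reciprocal_split _ _ _ rA0); apply: eq_bigr => j _.
congr (_ - _).
have alC : al^* = toC (u / 2) + 'i * toC (v / 2).
  have conjM (a c : C) : (a * c)^* = a^* * c^* by exact: rmorphM.
  by rewrite /al rmorphB /= conj_toC conjM conj_toC conjCi mulNr opprK.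
have e1 : al * al^* = toC ((u ^+ 2 + v ^+ 2) / 4).
  rewrite alC /al -subr_sqr exprMn sqrCi mulN1r opprK.
  by rewrite -!(rmorphXn toC) -(rmorphD toC); congr (toC _); field.
have e2 : al + al^* = toC u.
  by rewrite alC /al addrACA addNr addr0 -rmorphD; congr (toC _); field.
transitivity ((toC (b j) * (4 * (al * al^*)) + toC (g j) * (al + al^*) ^+
  2)%:P).
  rewrite rmorph0; ring.
rewrite e1 e2; congr _%:P.
by rewrite -(rmorph_nat toC) -(rmorphXn toC) -!(rmorphM toC) -(rmorphD toC);
  congr (toC _); field.
Qed.

Lemma det_pencil_reciprocal (A : 'M[C]_6) e z :
  reciprocal_with A (fun k => x k + e) ->
  \det (pencil (A - z%:M)) = \prod_(j < 3) quad_pencil z (b j + g j * e) (g j).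
Proof.
move=> rA.
have -> : pencil (A - z%:M) = (- ((z^*)%:P + z%:P * 'X))%:M
    + 'X *: map_mx polyC A + 1 *: map_mx polyC (A^t*).
  apply/matrixP => i j; rewrite pencilE !mxE rmorphB /= rmorphMn /= eq_sym.
  case: (i == j); rewrite ?mulr1n ?mulr0n; ring.
rewrite (det_reciprocal_split _ _ _ rA); apply: eq_bigr => j _.
rewrite /quad_pencil (rmorphM toC 4) (rmorph_nat toC) (rmorphD toC) (rmorphM
  toC); ring.
Qed.
End Tridiagonal.

(** * The numerical range lies in the elliptical disk *)

Section Compression.
Variable C : numClosedFieldType.

Lemma hermitian_diag n (N : 'M[C]_n) (ds : seq C) :
  N^t* = N -> char_poly N = \prod_(d <- ds) ('X - d%:P) ->
  exists U : 'M[C]_n, exists2 D : 'rV[C]_n,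
    U \is unitarymx /\ N = U^t* *m diag_mx D *m U &
    perm_eq [seq D 0 i | i : 'I_n] ds.
Proof.
move=> hN cN; have nN : N \is normalmx by apply/normalmxP; rewrite hN.
have uU := spectral_unitarymx N; have /orthomx_spectralP := nN.
rewrite invmx_unitary //; set U := spectralmx N in uU *.
set D := spectral_diag N => E; exists U, D => //.
apply: prod_XsubC_eq; rewrite -cN big_map big_enum /=.
have -> : \prod_(i < n) ('X - (D 0 i)%:P) = char_poly (diag_mx D).
  rewrite char_poly_trig ?diag_mx_is_trig //.
  by apply: eq_bigr => i _; rewrite mxE eqxx.
have UU : U^t* *m U = 1%:M by rewrite -[LHS]mul1mx mulmxA mulmxKtV.
rewrite /char_poly; set XD := char_poly_mx (diag_mx D).
have -> : char_poly_mx N = map_mx polyC (U^t*) *m XD *m map_mx polyC U.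
  rewrite /XD /char_poly_mx mulmxBr mulmxBl -!(map_mxM polyC) -E.
  by rewrite mul_mx_scalar -scalemxAl -(map_mxM polyC) UU map_mx1 scalemx1.
rewrite !det_mulmx mulrAC -det_mulmx -(map_mxM polyC) UU map_mx1 det1 mul1r //.
Qed.

(** Courant-Fischer: by dimension, the range of [P] contains a nonzero vector orthogonal to every
    eigenvector whose eigenvalue is not at most [s]. Its Rayleigh quotient is [t], and is at most
    [s]. *)
Lemma compression_bound n (N P : 'M[C]_n) (ds : seq C) (s t : C) :
  N^t* = N -> char_poly N = \prod_(d <- ds) ('X - d%:P) ->
  P^t* = P -> P *m P = P -> P *m N *m P = t *: P ->
  (count (fun d => ~~ (d <= s)%R) ds < \rank P)%N -> t <= s.
Proof.
move=> hN cN hP PP PNP cnt.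
have [U [D [uU NE] Dds]] := hermitian_diag hN cN.
pose B := row_base P; pose W := B *m U^t*.
pose I := [set i | ~~ (D 0 i <= s)].
have cI : (#|I| < \rank P)%N.
  rewrite -(permP Dds) in cnt.
  apply: leq_ltn_trans cnt; rewrite count_map -sum1_count big_enum_cond
    sum1_card.
  by apply/eq_leq/eq_card => i; rewrite !inE.
(* Coordinates of the basis along the excluded eigenvectors: fewer columns than rows, so [K] has a
   left kernel. *)
pose K := \matrix_(i < \rank P, k < #|I|) W i (enum_val k).
have [y y0 yK] : exists2 y : 'rV_(\rank P), y != 0 & y *m K = 0.
  have : kermx K != 0.
    rewrite -mxrank_eq0 mxrank_ker -lt0n subn_gt0.
    by apply: leq_ltn_trans (rank_leq_col _) cI.
  case/rowV0Pn => y yk y0; exists y => //; exact/sub_kermxP.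
pose x := y *m B.
have x0 : x != 0 by rewrite /x mulmx_free_eq0 // row_base_free.
have xP : x *m P = x.
  have : (x <= P)%MS by rewrite /x mulmx_sub // eq_row_base.
  by case/submxP => v ->; rewrite -mulmxA PP.
pose w := x *m U^t*.
have wI i : i \in I -> w 0 i = 0.
  move=> iI; have := congr1 (fun M : 'rV_#|I| => M 0 (enum_rank_in iI i)) yK.
  rewrite /w /x -mulmxA -/W !mxE => E; rewrite -[RHS]E.
  by apply: eq_bigr => k _; rewrite !mxE enum_rankK_in.
clearbody x.
have xx : (x *m x^t*) 0 0 = (w *m w^t*) 0 0.
  by rewrite /w adjM trmxCK mulmxA mulmxKtV // trmxC_unitary.
have xNx : (x *m N *m x^t*) 0 0 = t * (x *m x^t*) 0 0.
  rewrite -[in LHS]xP adjM hP -!mulmxA (mulmxA P) (mulmxA (P *m N)) PNP.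
  by rewrite -scalemxAl -scalemxAr mxE mulmxA xP.
have : (x *m N *m x^t*) 0 0 <= s * (x *m x^t*) 0 0.
  have wE : x *m U^t* = w by [].
  have wC : U *m x^t* = w^t* by rewrite /w adjM trmxCK.
  rewrite NE xx !mulmxA wE -mulmxA wC; move: w {xx xNx wE wC} wI => w wI.
  rewrite !mxE mulr_sumr; apply: ler_sum => i _.
  rewrite mul_mx_diag !mxE -mulrA mulrCA -normCK.
  have [iI|] := boolP (i \in I); first by rewrite wI // normr0 expr0n !mulr0.
  by rewrite inE negbK => le; rewrite ler_wpM2r // exprn_ge0.
rewrite xNx ler_pM2r //; have := dotmx_is_dotmx x0; by rewrite dotmxE.
Qed.
End Compression.

Section Upper.
Variable R : realType.
Local Notation C := R[i].
Local Notation toC := (real_complex R).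
Local Notation Re := (@complex.Re R).
Local Notation Im := (@complex.Im R).
Lemma conj_pencil_coef (u v : R) :
  (toC u - 'i * toC v)^* = toC u + 'i * toC v.
Proof.
have conjM (a c : C) : (a * c)^* = a^* * c^* by exact: rmorphM.
by rewrite rmorphB /= conj_toC conjM conj_toC conjCi mulNr opprK.
Qed.

Variables (x b g : nat -> R).
Hypothesis split : match6_splits (x 0%N) (x 1%N) (x 2%N) (x 3%N) (x 4%N) b g.
Hypothesis b_ge0 : forall j, (j < 3)%N -> 0 <= b j.
Hypothesis g_ge0 : forall j, (j < 3)%N -> 0 <= g j.
Hypothesis b_mono : forall i j, (i <= j < 3)%N -> b j <= b i.
Hypothesis g_mono : forall i j, (i <= j < 3)%N -> g j <= g i.
Variable A : 'M[C]_6.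
Hypothesis rA : reciprocal_with A x.

(** The support function of the disk with squared half-axes [b j + g j] and [b j]; the index [j] is
    0-based. *)
Definition ellipse_support (j : nat) (u v : R) : R :=
  Num.sqrt ((b j + g j) * u ^+ 2 + b j * v ^+ 2).

Definition support_spectrum (u v : R) : seq R :=
  let s j := ellipse_support j u v in
  [:: s 0%N; s 1%N; s 2%N; - s 2%N; - s 1%N; - s 0%N].

Lemma ellipse_support_mono i j u v : (i <= j < 3)%N ->
  ellipse_support j u v <= ellipse_support i u v.
Proof.
by move=> ij; rewrite ler_wsqrtr // lerD // ler_wpM2r ?sqr_ge0 ?lerD ?b_mono
  ?g_mono.
Qed.

Lemma sqr_ellipse_support j u v : (j < 3)%N ->
  ellipse_support j u v ^+ 2 = (b j + g j) * u ^+ 2 + b j * v ^+ 2.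
Proof.
by move=> j3; rewrite sqr_sqrtr // addr_ge0 // mulr_ge0 ?addr_ge0 ?sqr_ge0
  ?b_ge0 ?g_ge0.
Qed.

Lemma char_poly_support_spectrum (u v : R) :
  let al := toC (u / 2) - 'i * toC (v / 2) in
  char_poly (al *: A + al^* *: A^t*) =
  \prod_(d <- map toC (support_spectrum u v)) ('X - d%:P).
Proof.
move=> al; rewrite (char_poly_reciprocal split _ _ rA).
rewrite !big_ord_recl big_ord0 mulr1 /= !big_cons big_nil mulr1 /bump /= !addn0.
rewrite -!sqr_ellipse_support //; ring.
Qed.

(** The compression of u Re A + v Im A is u Re z + v Im z times [P], and at most [j] eigenvalues
    exceed the support value, fewer than the rank [j.+1]. *)
Lemma numerical_range_support j z u v : (j < 3)%N -> numerical_range j.+1 A z ->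
  Re z * u + Im z * v <= ellipse_support j u v.
Proof.
move=> j3 [P [hP PP rkP PAP]].
pose al := toC (u / 2) - 'i * toC (v / 2).
have alC : al^* = toC (u / 2) + 'i * toC (v / 2) by exact: conj_pencil_coef.
set N := al *: A + al^* *: A^t*.
have hN : N^t* = N by rewrite /N adjD !adjZ trmxCK conjCK addrC.
have PAP' : P *m A^t* *m P = z^* *: P.
  by have := congr1 (fun M => M^t*) PAP; rewrite /= !adjM adjZ hP mulmxA.
have PNP : P *m N *m P = toC (Re z * u + Im z * v) *: P.
  rewrite /N mulmxDr mulmxDl -!scalemxAr -!scalemxAl PAP PAP' !scalerA
    -scalerDl.
  congr (_ *: _); rewrite alC /al {hP PP PAP PAP' hN N}.
  case: z => a c; rewrite -complexiE /=.
  by apply/eqP; rewrite eq_complex /=; apply/andP; split; apply/eqP; field.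
rewrite -lecR; apply: (compression_bound hN (char_poly_support_spectrum u v) hP
  PP PNP).
rewrite rkP count_map ltnS.
have sP k : 0 <= ellipse_support k u v by exact: sqrtr_ge0.
have sN k : - ellipse_support k u v <= ellipse_support j u v.
  by apply: le_trans (sP j); rewrite oppr_le0.
rewrite /= !lecR !sN /=.
case: j j3 {rkP sN} => [|[|[|//]]] _.
- by rewrite !ellipse_support_mono.
- by rewrite lexx (@ellipse_support_mono 1 2) //; case: (~~ _).
- by rewrite lexx; case: (~~ _); case: (~~ _).
Qed.

Lemma numerical_range_sub j z : (j < 3)%N -> numerical_range j.+1 A z ->
  forall u v, (Re z * u + Im z * v) ^+ 2 <= (b j + g j) * u ^+ 2 + b j * v ^+ 2.
Proof.
move=> j3 zA u v; rewrite -sqr_ellipse_support //.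
have le1 := numerical_range_support u v j3 zA.
have le2 := numerical_range_support (- u) (- v) j3 zA.
have sE : ellipse_support j (- u) (- v) = ellipse_support j u v.
  by rewrite /ellipse_support !sqrrN.
rewrite -[leLHS]real_normK ?num_real // ler_sqr ?nnegrE ?sqrtr_ge0 //.
by rewrite ler_norml le1 andbT; move: le2; rewrite sE; lra.
Qed.

(** Im A is the case u = 0, v = 1. The roots in [eigenvalues] come in an unspecified order, but the
    sorted list is unique. *)
Lemma herm_eigenvalues_im_part j : (j < 3)%N ->
  nth 0 (herm_eigenvalues (im_part A)) j = Num.sqrt (b j).
Proof.
move=> j3.
have -> : im_part A = let al := toC (0 / 2) - 'i * toC (1 / 2) in al *: A + al^*
  *: A^t*.
  rewrite /im_part /=.
  have -> : (2 * 'i%C)^-1 = - 'i * toC (1 / 2) :> C.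
    rewrite -complexiE; apply/eqP; rewrite eq_complex /=.
    by apply/andP; split; apply/eqP; field.
  by rewrite conj_pencil_coef mul0r rmorph0 sub0r add0r scalerBr mulNr !scaleNr
    opprK.
rewrite /herm_eigenvalues /eigenvalues.
case: (closed_field_poly_normal (char_poly _)) => ds /= E.
have pds : perm_eq ds (map toC (support_spectrum 0 1)).
  apply: prod_XsubC_eq; rewrite -(char_poly_support_spectrum 0 1) [RHS]E.
  by rewrite (monicP (char_poly_monic _)) scale1r.
have {}pds : perm_eq (map Re ds) (support_spectrum 0 1).
  by rewrite (perm_trans (perm_map Re pds)) // -map_comp map_id.
have geT : total (fun a c : R => c <= a) by move=> a c; rewrite le_total.
have geTr : transitive (fun a c : R => c <= a) by move=> a c d ac ca; exact:
  le_trans ca ac.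
have geA : antisymmetric (fun a c : R => c <= a) by move=> a c; rewrite andbC =>
  /le_anti.
rewrite (perm_sortP geT geTr geA _ _ pds) sorted_sort //; last first.
  rewrite /= !lerN2 (@ellipse_support_mono 0 1) // (@ellipse_support_mono 1 2)
    //.
  by rewrite !andbT (@le_trans _ _ 0) ?oppr_le0 // sqrtr_ge0.
case: j j3 => [|[|[|//]]] _ /=; rewrite /ellipse_support expr0n mulr0 add0r
  expr1n mulr1 //.
Qed.
End Upper.

(** * The elliptical disk lies in the numerical range *)

Section Compactness.
Variable R : realType.
Local Notation C := R[i].
Local Notation toC := (real_complex R).
Local Notation Re := (@complex.Re R).
Local Notation Im := (@complex.Im R).

Lemma ReM (a c : C) : Re (a * c) = Re a * Re c - Im a * Im c.
Proof. by case: a; case: c. Qed.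

Lemma ImM (a c : C) : Im (a * c) = Re a * Im c + Im a * Re c.
Proof. by case: a => a a'; case: c => c c' /=. Qed.

Section ComplexContinuous.
Variable T : topologicalType.

(** Stated through real and imaginary parts, so that only the topology of [R] is involved. *)
Definition ccontinuous (h : T -> C) : Prop :=
  continuous (Re \o h) /\ continuous (Im \o h).

Lemma ccontinuous_cst c : ccontinuous (fun=> c).
Proof. by split; apply: cst_continuous. Qed.

Lemma ccontinuousD h k : ccontinuous h -> ccontinuous k ->
  ccontinuous (fun w => h w + k w).
Proof.
move=> [h1 h2] [k1 k2]; split=> w.
- have -> : Re \o (fun w => h w + k w) = (Re \o h) \+ (Re \o k).
    by apply/funext => v /=; rewrite raddfD.
  by apply: continuousD; [exact: h1 | exact: k1].
- have -> : Im \o (fun w => h w + k w) = (Im \o h) \+ (Im \o k).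
    by apply/funext => v /=; rewrite raddfD.
  by apply: continuousD; [exact: h2 | exact: k2].
Qed.

Lemma ccontinuousM h k : ccontinuous h -> ccontinuous k ->
  ccontinuous (fun w => h w * k w).
Proof.
move=> [h1 h2] [k1 k2]; split=> w.
- have -> : Re \o (fun w => h w * k w) =
      ((Re \o h) \* (Re \o k)) \- ((Im \o h) \* (Im \o k)).
    by apply/funext => v /=; rewrite ReM.
  by apply: continuousB; apply: continuousM;
    [exact: h1 | exact: k1 | exact: h2 | exact: k2].
- have -> : Im \o (fun w => h w * k w) =
      ((Re \o h) \* (Im \o k)) \+ ((Im \o h) \* (Re \o k)).
    by apply/funext => v /=; rewrite ImM.
  by apply: continuousD; apply: continuousM;
    [exact: h1 | exact: k2 | exact: h2 | exact: k1].
Qed.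

Lemma ccontinuous_conj h : ccontinuous h -> ccontinuous (fun w => (h w)^*).
Proof.
move=> [h1 h2]; split=> w.
- have -> : Re \o (fun w => (h w)^*) = Re \o h.
    by apply/funext => v /=; case: (h v).
  exact: h1.
- have -> : Im \o (fun w => (h w)^*) = \- (Im \o h).
    by apply/funext => v /=; case: (h v).
  by apply: continuousN; exact: h2.
Qed.

Lemma ccontinuous_sum (I : Type) (r : seq I) (h : I -> T -> C) :
  (forall i, ccontinuous (h i)) -> ccontinuous (fun w => \sum_(i <- r) h i w).
Proof.
move=> hc; elim: r => [|i r IH].
  have -> : (fun w => \sum_(i <- [::]) h i w) = (fun=> 0).
    by apply/funext => w; rewrite big_nil.
  exact: ccontinuous_cst.
have -> : (fun w => \sum_(i <- i :: r) h i w) = (fun w => h i w + \sum_(i <- r)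
  h i w).
  by apply/funext => w; rewrite big_cons.
exact: ccontinuousD.
Qed.

Definition mcontinuous m n (V : T -> 'M[C]_(m, n)) : Prop :=
  forall i j, ccontinuous (fun w => V w i j).

Lemma mcontinuous_mul m n p (V : T -> 'M[C]_(m, n)) (W : T -> 'M[C]_(n, p)) :
  mcontinuous V -> mcontinuous W -> mcontinuous (fun w => V w *m W w).
Proof.
move=> Vc Wc i j.
have -> : (fun w => (V w *m W w) i j) = (fun w => \sum_k V w i k * W w k j).
  by apply/funext => w; rewrite mxE.
by apply: ccontinuous_sum => k; apply: ccontinuousM.
Qed.

Lemma mcontinuous_adj m n (V : T -> 'M[C]_(m, n)) :
  mcontinuous V -> mcontinuous (fun w => (V w)^t*).
Proof.
move=> Vc i j; have -> : (fun w => (V w)^t* i j) = (fun w => (V w j i)^*).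
  by apply/funext => w; rewrite !mxE.
exact: ccontinuous_conj.
Qed.

Lemma mcontinuous_cst m n (V : 'M[C]_(m, n)) : mcontinuous (fun=> V).
Proof. by move=> i j; apply: ccontinuous_cst. Qed.

Lemma mcontinuousD m n (V W : T -> 'M[C]_(m, n)) :
  mcontinuous V -> mcontinuous W -> mcontinuous (fun w => V w + W w).
Proof.
move=> Vc Wc i j; have -> : (fun w => (V w + W w) i j) = (fun w => V w i j + W w
  i j).
  by apply/funext => w; rewrite mxE.
exact: ccontinuousD.
Qed.

(** The squared Frobenius norm, with values in [R] so that it can be minimized. *)
Definition sqnorm m n (V : 'M[C]_(m, n)) : R :=
  \sum_i \sum_j (Re (V i j) ^+ 2 + Im (V i j) ^+ 2).

Lemma sqnorm_ge0 m n (V : 'M[C]_(m, n)) : 0 <= sqnorm V.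
Proof. by do 2 (apply: sumr_ge0 => ? _); rewrite addr_ge0 ?sqr_ge0. Qed.

Lemma sqnorm_eq0 m n (V : 'M[C]_(m, n)) : sqnorm V = 0 -> V = 0.
Proof.
move=> /eqP; rewrite psumr_eq0 => [/allP V0|i _]; last first.
  by apply: sumr_ge0 => ? _; rewrite addr_ge0 ?sqr_ge0.
apply/matrixP => i j; rewrite mxE; have /implyP/(_ isT) := V0 i (mem_index_enum
  _).
rewrite psumr_eq0 => [/allP/(_ j (mem_index_enum _))/=|k _]; last first.
  by rewrite addr_ge0 ?sqr_ge0.
rewrite paddr_eq0 ?sqr_ge0 // !sqrf_eq0; case: (V i j) => a c /= /andP[/eqP->
  /eqP->].
by [].
Qed.

Lemma sum_continuous (I : Type) (r : seq I) (h : I -> T -> R) :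
  (forall i, continuous (h i)) -> continuous (fun w => \sum_(i <- r) h i w).
Proof.
move=> hc; elim: r => [|i r IH].
  have -> : (fun w => \sum_(i <- [::]) h i w) = (fun=> 0).
    by apply/funext => w; rewrite big_nil.
  exact: cst_continuous.
have -> : (fun w => \sum_(i <- i :: r) h i w) = (fun w => h i w + \sum_(i <- r)
  h i w).
  by apply/funext => w; rewrite big_cons.
by move=> w; apply: continuousD; [exact: hc | exact: IH].
Qed.

Lemma sqnorm_continuous m n (V : T -> 'M[C]_(m, n)) :
  mcontinuous V -> continuous (fun w => sqnorm (V w)).
Proof.
move=> Vc; rewrite /sqnorm.
do 2 (apply: sum_continuous => ?); move=> w.
apply: (@continuousD _ _ _ (fun w => Re (V w _ _) ^+ 2) (fun w => Im (V w _ _)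
  ^+ 2)).
- by apply: (@continuousM _ _ (Re \o (fun w => V w _ _)) (Re \o (fun w => V w _
    _)));
    exact: (Vc _ _).1.
- by apply: (@continuousM _ _ (Im \o (fun w => V w _ _)) (Im \o (fun w => V w _
    _)));
    exact: (Vc _ _).2.
Qed.

End ComplexContinuous.

(** Real coordinates on the complex matrices, in which boxes are compact. *)
Definition row_to_mx m n (w : 'rV[R]_(m * n + m * n)) : 'M[C]_(m, n) :=
  \matrix_(i, j) (vec_mx (lsubmx w) i j +i* vec_mx (rsubmx w) i j)%C.

Lemma mcontinuous_row_to_mx m n : mcontinuous (@row_to_mx m n).
Proof.
move=> i j; split.
- have -> : Re \o (fun w => @row_to_mx m n w i j) =
      fun w => w 0 (lshift _ (mxvec_index i j)).
    by apply/funext => w /=; rewrite !mxE.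
  exact: coord_continuous.
- have -> : Im \o (fun w => @row_to_mx m n w i j) =
      fun w => w 0 (rshift _ (mxvec_index i j)).
    by apply/funext => w /=; rewrite !mxE.
  exact: coord_continuous.
Qed.

Definition mx_to_row m n (V : 'M[C]_(m, n)) : 'rV[R]_(m * n + m * n) :=
  row_mx (mxvec (map_mx Re V)) (mxvec (map_mx Im V)).

Lemma mx_to_rowK m n : cancel (@mx_to_row m n) (@row_to_mx m n).
Proof.
move=> V; apply/matrixP => i j; rewrite mxE /mx_to_row row_mxKl row_mxKr !mxvecK
  !mxE.
by case: (V i j).
Qed.

Lemma unitary_entry_le1 m n (V : 'M[C]_(m, n)) i j :
  V \is unitarymx -> `|V i j| <= 1.
Proof.
move=> /unitarymxP/matrixP/(_ i i); rewrite !mxE eqxx => E.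
have : `|V i j| ^+ 2 <= 1.
  rewrite -[leRHS]E (bigD1 j) //= !mxE -normCK lerDl.
  by apply: sumr_ge0 => k _; rewrite !mxE mul_conjC_ge0.
by rewrite expr_le1.
Qed.

Lemma mx_to_row_le1 m n (V : 'M[C]_(m, n)) k :
  V \is unitarymx -> `|mx_to_row V 0 k| <= 1.
Proof.
move=> uV; have le1 i j : `|Re (V i j)| <= 1 /\ `|Im (V i j)| <= 1.
  have := unitary_entry_le1 i j uV.
  rewrite normc_def -(rmorph1 toC) lecR => le1.
  have le2 : Re (V i j) ^+ 2 + Im (V i j) ^+ 2 <= 1.
    by rewrite -(sqr_sqrtr (addr_ge0 (sqr_ge0 _) (sqr_ge0 _))) expr_le1
      ?sqrtr_ge0.
  split; rewrite -(@expr_le1 _ 2) // real_normK ?num_real //.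
    by apply: le_trans le2; rewrite lerDl sqr_ge0.
  by apply: le_trans le2; rewrite lerDr sqr_ge0.
rewrite /mx_to_row mxE; case: split_ordP => l _; case/mxvec_indexP: l => i j;
  by rewrite mxvecE mxE; case: (le1 i j).
Qed.

(* Minimizing over a box the sum of the defects of both equations spares us the
   compactness of the set of isometries. *)
Lemma unitary_limit k n (M : 'M[C]_n) (N : 'M[C]_k) :
  (forall d : R, 0 < d -> exists2 V : 'M[C]_(k, n), V \is unitarymx &
     sqnorm (V *m M *m V^t* - N) <= d) ->
  exists2 V : 'M[C]_(k, n), V \is unitarymx & V *m M *m V^t* = N.
Proof.
move=> app.
pose f (w : 'rV[R]_(k * n + k * n)) : R := let V := row_to_mx w in
  sqnorm (V *m V^t* - 1%:M) + sqnorm (V *m M *m V^t* - N).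
pose K : set 'rV[R]_(k * n + k * n) :=
  [set w | forall i, `[(-1), 1]%classic (w ord0 i)]%classic.
have Kc : compact K.
  apply: (@rV_compact R _ (fun=> `[(-1), 1]%classic)) => _; exact:
    segment_compact.
have KV V : V \is unitarymx -> K (mx_to_row V).
  by move=> uV i /=; rewrite in_itv /= -ler_norml mx_to_row_le1.
have fc : ({within K, continuous f})%classic.
  apply: continuous_subspaceT => w.
  have cV := @mcontinuous_row_to_mx k n.
  have cVV : mcontinuous (fun w => @row_to_mx k n w *m (row_to_mx w)^t* + -
    1%:M).
    apply: mcontinuousD; last exact: mcontinuous_cst.
    by apply: mcontinuous_mul => //; exact: mcontinuous_adj.
  have cVMV : mcontinuous (fun w => @row_to_mx k n w *m M *m (row_to_mx w)^t* +
    - N).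
    apply: mcontinuousD; last exact: mcontinuous_cst.
    apply: mcontinuous_mul; last exact: mcontinuous_adj.
    by apply: mcontinuous_mul => //; exact: mcontinuous_cst.
  exact: continuousD (@sqnorm_continuous _ _ _ _ cVV w) (@sqnorm_continuous _ _
    _ _ cVMV w).
have K0 : (K !=set0)%classic.
  by have [V uV _] := app 1 ltr01; exists (mx_to_row V); exact: KV.
have [w wK wmin] := EVT_min_rV K0 Kc fc.
have fw : f w = 0.
  apply/eqP; rewrite eq_le [0 <= _]addr_ge0 ?sqnorm_ge0 // andbT leNgt;
    apply/negP => f0.
  (* An approximate solution with defect at most half of a positive minimum would beat it. *)
  have f2 : 0 < f w / 2 by rewrite divr_gt0.
  have [V uV Vle] := app _ f2.
  have := wmin (mx_to_row V); rewrite inE => /(_ (KV _ uV)).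
  rewrite {2}/f mx_to_rowK (unitarymxP uV) subrr.
  have -> : sqnorm (0 : 'M[C]_k) = 0.
    by rewrite /sqnorm; do 2 (apply: big1 => ? _); rewrite mxE /= expr0n addr0.
  by move: Vle f0; lra.
move/eqP: fw; rewrite /f /= paddr_eq0 ?sqnorm_ge0 // => /andP[/eqP e1 /eqP e2].
exists (row_to_mx w); last by apply/eqP; rewrite -subr_eq0 (sqnorm_eq0 e2).
by apply/unitarymxP/eqP; rewrite -subr_eq0 (sqnorm_eq0 e1).
Qed.
End Compactness.

(** * Perturbation of the parameters and passage to the limit *)

Section Lower.
Variable R : realType.
Local Notation C := R[i].
Local Notation toC := (real_complex R).
Local Notation Re := (@complex.Re R).
Local Notation Im := (@complex.Im R).

Lemma sqrtD_sub (y e : R) : 0 <= y -> 0 <= e ->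
  `|Num.sqrt (y + e) - Num.sqrt y| <= Num.sqrt e.
Proof.
move=> y0 e0; rewrite ger0_norm ?subr_ge0 ?ler_wsqrtr ?lerDl //.
rewrite lerBlDr -ler_sqr ?nnegrE ?addr_ge0 ?sqrtr_ge0 //.
rewrite sqrrD !sqr_sqrtr ?addr_ge0 // addrAC [e + y]addrC lerDl.
by rewrite mulrn_wge0 // mulr_ge0 ?sqrtr_ge0.
Qed.

(* p = m + d and p^-1 = m - d with m ^+ 2 = y + 1 and d ^+ 2 = y. *)
Lemma perturb_pair (p y e : R) : 0 < p -> 0 <= y -> 0 <= e ->
  p ^+ 2 + p^-1 ^+ 2 = 4 * y + 2 ->
  exists p', [/\ 0 < p', p' ^+ 2 + p'^-1 ^+ 2 = 4 * (y + e) + 2,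
    `|p' - p| <= 2 * Num.sqrt e & `|p'^-1 - p^-1| <= 2 * Num.sqrt e].
Proof.
move=> p0 y0 e0 pE; have pN0 : p != 0 by rewrite gt_eqF.
pose m := (p + p^-1) / 2; pose d := (p - p^-1) / 2.
have m0 : 0 < m by rewrite divr_gt0 // addr_gt0 ?invr_gt0.
have mE : m ^+ 2 = y + 1.
  transitivity ((p ^+ 2 + p^-1 ^+ 2 + 2) / 4); first by rewrite /m; field.
  by rewrite pE; field.
have dE : d ^+ 2 = y.
  transitivity ((p ^+ 2 + p^-1 ^+ 2 - 2) / 4); first by rewrite /d; field.
  by rewrite pE; field.
pose m' := Num.sqrt (y + 1 + e).
have m'E : m' ^+ 2 = y + 1 + e by rewrite sqr_sqrtr // !addr_ge0.
have m'm : `|m' - m| <= Num.sqrt e.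
  have -> : m = Num.sqrt (y + 1) by rewrite -mE sqrtr_sqr gtr0_norm.
  by rewrite sqrtD_sub ?addr_ge0.
(* [d'] is the square root of [y + e] with the sign of [d], which keeps it close to [d]. *)
have [d' d'E d'd] : exists2 d', d' ^+ 2 = y + e & `|d' - d| <= Num.sqrt e.
  have [d0|d0] := leP 0 d.
    exists (Num.sqrt (y + e)); first by rewrite sqr_sqrtr ?addr_ge0.
    have -> : d = Num.sqrt y by rewrite -dE sqrtr_sqr ger0_norm.
    exact: sqrtD_sub.
  exists (- Num.sqrt (y + e)); first by rewrite sqrrN sqr_sqrtr ?addr_ge0.
  have -> : d = - Num.sqrt y by rewrite -dE sqrtr_sqr ltr0_norm // opprK.
  have -> : - Num.sqrt (y + e) - - Num.sqrt y = - (Num.sqrt (y + e) - Num.sqrt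
    y).
    by ring.
  by rewrite normrN sqrtD_sub.
have md : (m' + d') * (m' - d') = 1 by rewrite mulrC -subr_sqr m'E d'E; ring.
have m'0 : 0 < m' by rewrite sqrtr_gt0; lra.
have p'0 : 0 < m' + d'.
  have : `|d'| < m'.
    by rewrite -ltr_sqr ?nnegrE // ?(ltW m'0) // real_normK ?num_real // d'E
      m'E; lra.
  by rewrite ltr_norml => /andP[]; lra.
have p'V : (m' + d')^-1 = m' - d'.
  by apply: (mulfI (lt0r_neq0 p'0)); rewrite md mulfV ?lt0r_neq0.
exists (m' + d'); split => //.
- rewrite p'V; transitivity (2 * (m' ^+ 2 + d' ^+ 2)); first by ring.
  by rewrite m'E d'E; ring.
- have -> : m' + d' - p = (m' - m) + (d' - d) by rewrite /m /d; field.
  by apply: le_trans (ler_normD _ _) _; lra.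
- rewrite p'V; have -> : m' - d' - p^-1 = (m' - m) - (d' - d) by rewrite /m /d;
    field.
  by apply: le_trans (ler_normB _ _) _; lra.
Qed.

Lemma norm_toC (a : R) : `|toC a| = toC `|a|.
Proof. by rewrite normc_def /= expr0n addr0 sqrtr_sqr. Qed.

(** Each superdiagonal entry is multiplied by the ratio of the moduli [p'] and [p] of
    [perturb_pair], and its mirror entry by the inverse ratio, which keeps the product 1. *)
Lemma reciprocal_perturb (A : 'M[C]_6) (x : nat -> R) e :
  reciprocal_with A x -> (forall k, (k < 5)%N -> 0 <= x k) -> 0 <= e ->
  exists2 A' : 'M[C]_6, reciprocal_with A' (fun k => x k + e) &
    forall i j, `|A' i j - A i j| <= toC (2 * Num.sqrt e).
Proof.
move=> [A0 A1] x0 e0.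
have : forall i : 'I_6, exists r : R, forall j : 'I_6, i.+1 = j ->
    [/\ r != 0,
      `|toC r * A i j| ^+ 2 + `|toC r^-1 * A j i| ^+ 2 = toC (4 * (x i + e) +
        2),
      `|toC r * A i j - A i j| <= toC (2 * Num.sqrt e) &
      `|toC r^-1 * A j i - A j i| <= toC (2 * Num.sqrt e)].
  move=> i; have [i5|i5] := ltnP i 5; last first.
    by exists 0 => j ij; have := ltn_ord j; lia.
  have jj : (i.+1 < 6)%N by [].
  have [ab sab] := A1 i (Ordinal jj) erefl.
  set a := A i _ in ab sab; set c := A _ i in ab sab.
  have [p pE] : exists p, `|a| = toC p.
    by rewrite normc_def; eexists.
  have a0 : a != 0 by apply: contra_eq_neq ab => ->; rewrite mul0r eq_sym
    oner_eq0.
  have p0 : 0 < p by rewrite -ltcR -pE normr_gt0.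
  have cE : `|c| = toC p^-1.
    have -> : toC p^-1 = (toC p)^-1 by rewrite fmorphV.
    rewrite -pE; apply: (mulfI (_ : `|a| != 0)); first by rewrite normr_eq0.
    by rewrite -normrM ab normr1 mulfV // normr_eq0.
  have py : p ^+ 2 + p^-1 ^+ 2 = 4 * x i + 2.
    by apply: (@complexI R); rewrite -sab pE cE rmorphD !rmorphXn.
  have [p' [p'0 p'E le1 le2]] := perturb_pair p0 (x0 _ i5) e0 py.
  have pN0 := lt0r_neq0 p0; have p'N0 := lt0r_neq0 p'0.
  exists (p' / p) => j ij; have -> : j = Ordinal jj by apply: val_inj; rewrite
    /= -ij.
  rewrite -/a -/c; split.
  - by rewrite mulf_neq0 ?invr_eq0.
  - rewrite !normrM pE cE !norm_toC -!(rmorphM toC) -!(rmorphXn toC) -rmorphD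
      -p'E.
    rewrite !gtr0_norm ?invr_gt0 ?divr_gt0 //; congr (toC _); field.
    by rewrite pN0 p'N0.
  - rewrite -{2}[a]mul1r -mulrBl normrM pE -(rmorph1 toC) -rmorphB norm_toC
      -rmorphM.
    rewrite lecR -{2}(gtr0_norm p0) -normrM mulrBl mul1r mulfVK //.
  - rewrite -{2}[c]mul1r -mulrBl normrM cE -(rmorph1 toC) -rmorphB norm_toC
      -rmorphM.
    rewrite lecR; have pV0 : 0 < p^-1 by rewrite invr_gt0.
    by rewrite -{2}(gtr0_norm pV0) -normrM mulrBl mul1r invf_div mulrAC mulfV //
      mul1r.
case/fin_all_exists => r rP.
have ee : 0 <= toC (2 * Num.sqrt e) by rewrite ler0c mulr_ge0 ?sqrtr_ge0.
pose A' := \matrix_(i, j) ((if (i < j)%N then toC (r i) else toC (r j)^-1) * A i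
  j).
exists A'.
  split=> [i j ij ji|i j ij]; first by rewrite mxE A0 // mulr0.
  have [r0 rE _ _] := rP i j ij; have [ab _] := A1 i j ij.
  rewrite !mxE -ij ltnSn ltnNge leqnSn /=; split=> //.
  by rewrite mulrACA ab mulr1 -rmorphM mulfV // rmorph1.
move=> i j; rewrite mxE.
have [ij|ij] := eqVneq i.+1 j.
  by have [_ _ le1 _] := rP i j ij; rewrite -ij ltnSn.
have [ji|ji] := eqVneq j.+1 i.
  by have [_ _ _ le2] := rP j i ji; rewrite -ji ltnNge leqnSn.
by rewrite A0 // mulr0 subrr normr0.
Qed.

Lemma sqnorm_conj_le k n (V : 'M[C]_(k, n)) (E : 'M[C]_n) (h : R) :
  V \is unitarymx -> (forall i j, `|E i j| <= toC h) -> 0 <= h ->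
  sqnorm (V *m E *m V^t*) <= k%:R * (k%:R * (n%:R * (n%:R * h)) ^+ 2).
Proof.
move=> uV Eh h0.
have entry i j : `|(V *m E *m V^t*) i j| <= toC (n%:R * (n%:R * h)).
  rewrite mxE; apply: le_trans (ler_norm_sum _ _ _) _.
  have -> : toC (n%:R * (n%:R * h)) = \sum_(l < n) toC (n%:R * h).
    by rewrite sumr_const card_ord (rmorphM toC) (rmorph_nat toC) mulr_natl.
  apply: ler_sum => l _; rewrite normrM.
  rewrite -[leRHS]mulr1 ler_pM ?normr_ge0 //; last first.
    by rewrite !mxE norm_conjC unitary_entry_le1.
  rewrite mxE; apply: le_trans (ler_norm_sum _ _ _) _.
  have -> : toC (n%:R * h) = \sum_(l < n) toC h.
    by rewrite sumr_const card_ord (rmorphM toC) (rmorph_nat toC) mulr_natl.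
  apply: ler_sum => m _; rewrite normrM -[leRHS]mul1r ler_pM ?normr_ge0 //.
  exact: unitary_entry_le1.
rewrite /sqnorm; have H0 : 0 <= n%:R * (n%:R * h) by rewrite !mulr_ge0.
set H := n%:R * (n%:R * h) in entry H0 *.
have -> : k%:R * (k%:R * H ^+ 2) = \sum_(i < k) \sum_(j < k) H ^+ 2 :> R.
  by rewrite !sumr_const card_ord !mulr_natl.
apply: ler_sum => i _; apply: ler_sum => j _.
rewrite -lecR add_Re2_Im2 rmorphXn /= ler_sqr ?nnegrE ?normr_ge0 ?ler0c //.
Qed.

(** The projection is the one onto the span of the rows of [V]. *)
Lemma isometry_numerical_range k n (A : 'M[C]_n) (V : 'M[C]_(k, n)) z :
  V \is unitarymx -> V *m A *m V^t* = z%:M -> numerical_range k A z.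
Proof.
move=> uV VA; exists (V^t* *m V); split.
- by rewrite adjM trmxCK.
- by rewrite mulmxA mulmxtVK.
- apply/eqP; rewrite eqn_leq; apply/andP; split.
    by apply: leq_trans (mxrankM_maxr _ _) (rank_leq_row _).
  rewrite -[X in (X <= _)%N](mxrank_unitary uV).
  have {1}-> : V = V *m (V^t* *m V) by rewrite mulmxA (unitarymxP uV) mul1mx.
  exact: mxrankM_maxr.
- rewrite -!mulmxA (mulmxA V A) (mulmxA (V *m A)) VA mul_scalar_mx -scalemxAr.
  by [].
Qed.

(** Both squared half-axes grow by [ga * e], which makes every point of the closed disk interior,
    even if [be = 0]. *)
Lemma support_strict (X Y be ga e : R) : 0 <= be -> 0 < ga -> 0 < e ->
  (forall u v, (X * u + Y * v) ^+ 2 <= (be + ga) * u ^+ 2 + be * v ^+ 2) ->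
  let bp := be + ga * e in
  X ^+ 2 + Y ^+ 2 < 2 * bp + ga /\
  bp * X ^+ 2 + (bp + ga) * Y ^+ 2 < (bp + ga) * bp.
Proof.
move=> be0 ga0 e0 le; have := mulr_gt0 ga0 e0; move: (ga * e) => dl dl0 bp.
have bp0 : 0 < bp by rewrite /bp; lra.
have le1 := le 1 0; have le2 := le 0 1.
have X2 : X ^+ 2 <= be + ga by lra.
have Y2 : Y ^+ 2 <= be by lra.
split; first by rewrite /bp; lra.
set Q := bp * X ^+ 2 + (bp + ga) * Y ^+ 2.
(* The test direction is again normal to the enlarged ellipse's family; the slack is [dl] times its
   squared length. *)
have le3 := le (bp * X) ((bp + ga) * Y).
have bg0 : 0 < bp + ga by lra.
have [Q0|Q0] := leP Q 0; first by apply: le_lt_trans Q0 _; rewrite mulr_gt0.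
rewrite -(ltr_pM2r Q0).
have -> : Q * Q = (X * (bp * X) + Y * ((bp + ga) * Y)) ^+ 2 by rewrite /Q; ring.
apply: le_lt_trans le3 _; rewrite -subr_gt0.
have -> : (bp + ga) * bp * Q - ((be + ga) * (bp * X) ^+ 2 + be * ((bp + ga) * Y)
  ^+ 2)
   = dl * ((bp * X) ^+ 2 + ((bp + ga) * Y) ^+ 2).
  by rewrite /Q /bp; ring.
rewrite mulr_gt0 // lt_neqAle addr_ge0 ?sqr_ge0 // andbT eq_sym.
rewrite paddr_eq0 ?sqr_ge0 // !sqrf_eq0 !mulf_eq0 (gt_eqF bp0) (gt_eqF bg0) /=.
apply/negP => /andP[/eqP X0 /eqP Y0].
by move: Q0; rewrite /Q X0 Y0 expr0n !mulr0 addr0 ltxx.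
Qed.

Section Splitting.
Variables (x b g : nat -> R).
Hypothesis split : match6_splits (x 0%N) (x 1%N) (x 2%N) (x 3%N) (x 4%N) b g.
Hypothesis x_ge0 : forall k, (k < 5)%N -> 0 <= x k.
Hypothesis b_ge0 : forall j, (j < 3)%N -> 0 <= b j.
Hypothesis g_gt0 : forall j, (j < 3)%N -> 0 < g j.
Hypothesis b_mono : forall i j, (i <= j < 3)%N -> b j <= b i.
Hypothesis g_mono : forall i j, (i <= j < 3)%N -> g j <= g i.
Variables (j : nat) (z : C).
Hypothesis j3 : (j < 3)%N.
Hypothesis z_support : forall u v,
  (Re z * u + Im z * v) ^+ 2 <= (b j + g j) * u ^+ 2 + b j * v ^+ 2.

(** The disks are nested because [b] and [g] are non-increasing, so [z] lies in each of the first
    [j.+1] disks and each of these factors splits. *)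
Lemma quad_pencil_prefix e k : 0 < e -> (k <= j.+1)%N ->
  exists mus : seq C, exists2 c : C, c != 0 &
    [/\ size mus = k, all (fun m => `|m| != 1) mus &
     \prod_(0 <= i < k) quad_pencil z (b i + g i * e) (g i) =
       c *: \prod_(m <- mus) (('X - m%:P) * (1 - m^* *: 'X))].
Proof.
move=> e0; elim: k => [|k IH] kj.
  by exists [::], 1; rewrite ?oner_eq0 //; split; rewrite // big_geq // big_nil
    scale1r.
have [mus [c c0 [sz al E]]] := IH (ltnW kj).
have k3 : (k < 3)%N by apply: leq_trans kj _.
have [|lt1 lt2] := support_strict (b_ge0 k3) (g_gt0 k3) e0 (X := Re z) (Y := Im
  z).
  move=> u v; apply: le_trans (z_support u v) _.
  by rewrite lerD // ler_wpM2r ?sqr_ge0 // ?lerD ?b_mono ?g_mono // j3 andbT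
    -ltnS.
have [m [c' c'0 [m1 qE]]] := quad_pencil_factor lt1 lt2.
exists (m :: mus), (c' * c); first by rewrite mulf_neq0.
split=> /=; [by rewrite sz | by rewrite m1 | ].
rewrite big_nat_recr //= E qE big_cons -scalerAl -scalerAr scalerA.
by congr (_ *: _); rewrite mulrC.
Qed.

(* For e > 0 the point z is strictly inside the first j + 1 ellipses of the
   perturbed matrix, even on the boundary or for a degenerate ellipse. *)
Lemma isometry_perturbed (A : 'M[C]_6) e : 0 < e ->
  reciprocal_with A (fun k => x k + e) ->
  exists2 V : 'M[C]_(j.+1, 6), V \is unitarymx & V *m A *m V^t* = z%:M.
Proof.
move=> e0 rA; have [mus [c c0 [sz al E]]] := quad_pencil_prefix e0 (leqnn _).
have dE := det_pencil_reciprocal split z rA.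
have [||V uV VE] := @isotropic_subspace _ _ (A - z%:M) mus _ al.
- rewrite dE; apply/prodf_neq0 => i _; apply: quad_pencil_neq0; last
    exact/ltW/g_gt0.
  by rewrite ltr_wpDl ?b_ge0 // mulr_gt0 // g_gt0.
- rewrite dE -(big_mkord xpredT (fun i => quad_pencil z (b i + g i * e) (g i))).
  by rewrite (@big_cat_nat _ _ _ j.+1) //= E -scalerAl dvdpZr // dvdp_mulr.
move: V uV VE; rewrite sz => V uV VE; exists V => //; apply/eqP.
rewrite -subr_eq0 -VE mulmxBr mulmxBl.
by rewrite mul_mx_scalar -scalemxAl (unitarymxP uV) scalemx1.
Qed.

Lemma sub_numerical_range (A : 'M[C]_6) :
  reciprocal_with A x -> numerical_range j.+1 A z.
Proof.
move=> rA; suff [V uV VA] : exists2 V : 'M[C]_(j.+1, 6),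
    V \is unitarymx & V *m A *m V^t* = z%:M.
  exact: isometry_numerical_range uV VA.
apply: unitary_limit => d d0.
(* [K * e] is the bound of [sqnorm_conj_le] for entries of size [2 * Num.sqrt e]; the choice of [e]
   makes it [d]. *)
pose K : R := j.+1%:R * (j.+1%:R * (6 * (6 * 2)) ^+ 2).
have K0 : 0 < K by rewrite /K !mulr_gt0 ?exprn_gt0.
pose e := d / K; have e0 : 0 < e by rewrite divr_gt0.
have [A' rA' AA'] := reciprocal_perturb rA x_ge0 (ltW e0).
have [V uV VA'] := isometry_perturbed e0 rA'.
exists V => //; rewrite -VA' -mulmxBl -mulmxBr.
have h0 : 0 <= 2 * Num.sqrt e by rewrite mulr_ge0 ?sqrtr_ge0.
have EA i k : `|(A - A') i k| <= toC (2 * Num.sqrt e).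
  by rewrite !mxE distrC AA'.
apply: le_trans (sqnorm_conj_le uV EA h0) _.
rewrite le_eqVlt; apply/orP; left; apply/eqP.
transitivity (K * Num.sqrt e ^+ 2); first by rewrite /K; ring.
by rewrite sqr_sqrtr ?ltW // /e mulrC divfK // gt_eqF.
Qed.
End Splitting.
End Lower.

(** * Reciprocal matrices satisfying the three equations *)

Local Open Scope complex_scope.
Local Open Scope classical_set_scope.

(** Moduli p, q with p q = 1 satisfy p^2 + q^2 = (p - q)^2 + 2. *)
Lemma reciprocal_recip_param (R : realType) (A : 'M[R[i]]_6) :
  reciprocal A -> reciprocal_with A (fun k => recip_param A k.+1).
Proof.
move=> [A0 A1]; split=> // i j ij; have ac := A1 i j ij; split=> //.
rewrite /recip_param /=.
have -> : inord i = i by apply: val_inj; rewrite /= inordK.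
have -> : inord i.+1 = j by apply: val_inj; rewrite /= inordK ij.
have nE (w : R[i]) : `|w| = (ComplexField.Normc.normc w)%:C by case: w.
have := congr1 Num.norm ac; rewrite normrM normr1 !nE -rmorphM => /complexI pq.
rewrite -!rmorphXn -rmorphD; congr (_%:C).
move: (_ (A i j)) (_ (A j i)) pq => p q pq.
by transitivity ((p - q) ^+ 2 + 2 * (p * q)); [ring | rewrite pq; field].
Qed.

Lemma recip_param_ge0 (R : realType) (A : 'M[R[i]]_6) k : 0 <= recip_param A k.
Proof. by rewrite mulr_ge0 ?sqr_ge0 ?invr_ge0. Qed.

Theorem corollary6 (R : realType) (A : 'M[R[i]]_6) (x1 x2 x3 x4 x5 : R)
  (hA : reciprocal A)
  (hx1 : x1 = recip_param A 1) (hx2 : x2 = recip_param A 2)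
  (hx3 : x3 = recip_param A 3) (hx4 : x4 = recip_param A 4)
  (hx5 : x5 = recip_param A 5)
  (h1 :
    2 * x1 ^+ 2 + 4 * x2 * x1 - 2 * x3 * x1 - 3 * x4 * x1 - 3 * x5 * x1
    + x2 ^+ 2 + x4 ^+ 2 + 2 * x5 ^+ 2 + 2 * x2 * x3
    - 5 * x2 * x4 + 2 * x3 * x4 - 3 * x2 * x5 - 2 * x3 * x5 + 4 * x4 * x5
    = 0)
  (h2 :
    2 * x1 ^+ 2 + x2 * x1 - 3 * x3 * x1 + x4 * x1 - 3 * x5 * x1
    - x2 ^+ 2 + x3 ^+ 2 - x4 ^+ 2 + 2 * x5 ^+ 2
    + 2 * x2 * x3 - 2 * x2 * x4 + 2 * x3 * x4 + x2 * x5 - 3 * x3 * x5 + x4 * x5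
    = 0)
  (h3 :
    x1 ^+ 3 + 2 * x2 * x1 ^+ 2 + 4 * x3 * x1 ^+ 2 + 2 * x4 * x1 ^+ 2
    + 3 * x5 * x1 ^+ 2 - x2 ^+ 2 * x1 + 3 * x3 ^+ 2 * x1 - x4 ^+ 2 * x1
    + 3 * x5 ^+ 2 * x1 + 3 * x2 * x3 * x1 - 2 * x2 * x4 * x1
    + 3 * x3 * x4 * x1 + 4 * x2 * x5 * x1 - 41 * x3 * x5 * x1
    + 4 * x4 * x5 * x1 - x2 ^+ 3 - x3 ^+ 3 - x4 ^+ 3 + x5 ^+ 3
    + 2 * x2 * x3 ^+ 2 - 3 * x2 * x4 ^+ 2 + x3 * x4 ^+ 2
    + 2 * x2 * x5 ^+ 2 + 4 * x3 * x5 ^+ 2 + 2 * x4 * x5 ^+ 2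
    + x2 ^+ 2 * x3 - 3 * x2 ^+ 2 * x4 + 2 * x3 ^+ 2 * x4 + 2 * x2 * x3 * x4
    - x2 ^+ 2 * x5 + 3 * x3 ^+ 2 * x5 - x4 ^+ 2 * x5
    + 3 * x2 * x3 * x5 - 2 * x2 * x4 * x5 + 3 * x3 * x4 * x5
    = 0) :
  forall j : nat, (1 <= j <= 3)%N ->
    numerical_range j A =
    elliptical_disk ((2 * cos (j%:R * pi / 7))%:C)
                    ((- (2 * cos (j%:R * pi / 7)))%:C)
                    (nth 0 (herm_eigenvalues (im_part A)) j.-1).
Proof.
move=> [//|j] j3; rewrite ltnS in j3; rewrite [j.+1.-1]/=.
(* [x], [b] and [g] are 0-based, and [j] is now one less than the rank. *)
pose x k := recip_param A k.+1; pose t : R := dcos7 R 2.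
pose b := height7 t x1 x2 x3 x4 x5; pose g := slope7 t.
have rA : reciprocal_with A x by exact: reciprocal_recip_param.
have split : match6_splits (x 0%N) (x 1%N) (x 2%N) (x 3%N) (x 4%N) b g.
  rewrite /x -hx1 -hx2 -hx3 -hx4 -hx5.
  exact: match6_splits7 (dcos7_min_poly R) h1 h2 h3.
have x_ge0 k : (k < 5)%N -> 0 <= x k by move=> _; exact: recip_param_ge0.
have gE i : (i < 3)%N -> g i = dcos7 R i.+1 ^+ 2 by exact: slope7_dcos7.
have g_gt0 i : (i < 3)%N -> 0 < g i by move=> i3; rewrite gE // exprn_gt0 //
  dcos7_gt0.
have g_lt i k : (i < k < 3)%N -> g k < g i.
  move=> ik; rewrite !gE; [|lia|lia].
  by rewrite ltr_sqr ?nnegrE ?ltW ?dcos7_gt0 ?dcos7_gt //; lia.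
have g_mono i k : (i <= k < 3)%N -> g k <= g i.
  case/andP; rewrite leq_eqVlt => /orP[/eqP-> //|ik k3].
  by rewrite ltW // g_lt // ik.
have b_ge0 i : (i < 3)%N -> 0 <= b i.
  by apply: (splits_height_ge0 split); exact: x_ge0.
have b_mono i k : (i <= k < 3)%N -> b k <= b i.
  case/andP; rewrite leq_eqVlt => /orP[/eqP-> //|ik k3].
  have ik3 : (i < k < 3)%N by rewrite ik.
  by apply: (splits_height_mono split) => //; [exact: x_ge0..| exact: g_lt].
have g_ge0 i : (i < 3)%N -> 0 <= g i by move=> /g_gt0/ltW.
rewrite (herm_eigenvalues_im_part split b_ge0 g_ge0 b_mono g_mono rA j3).
(* In [elliptical_diskP], the squared minor half-axis is [b j] and the squared distance from the
   center to a focus is [g j]. *)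
apply/seteqP; split => z.
  move=> zA; apply/elliptical_diskP => u v.
  have := numerical_range_sub split b_ge0 g_ge0 b_mono g_mono rA j3 zA u v.
  by rewrite sqr_sqrtr ?b_ge0 // gE.
move/elliptical_diskP => zE.
apply: (sub_numerical_range split x_ge0 b_ge0 g_gt0 b_mono g_mono j3 _ rA) => u
  v.
by have := zE u v; rewrite sqr_sqrtr ?b_ge0 // gE.
Qed.
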